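(* Let $a>1$, let $\Psi=\{\psi_1,\psi_2,\dots,\psi_L\}$ be a finite subset of $L^2(\mathbb{R}_+)$ with cardinality $L$, and let $0<B<\infty$. Then $\mathcal{MD}(\Psi,a)$ is a Bessel sequence in $L^2(\mathbb{R}_+)$ with Bessel bound $B$ if and only if $$\sum_{l=1}^{L}\left|\Theta_a\psi_l(x,\xi)\right|^2\le B\quad\text{for a.e. }(x,\xi)\in[1,a)\times[0,1).$$
   Context: $\mathbb{R}_+=(0,\infty)$, and $L^2(\mathbb{R}_+)$ is the space of complex-valued square-integrable functions on $\mathbb{R}_+$. A measurable function $h$ on $\mathbb{R}_+$ is $a$-dilation periodic if $h(ax)=h(x)$ for a.e. $x\in\mathbb{R}_+$. For $m\in\mathbb{Z}$, $\Lambda_m$ is the $a$-dilation periodic function on $\mathbb{R}_+$ determined by $\Lambda_m(x)=\frac{1}{\sqrt{a-1}}e^{\frac{2\pi i m x}{a-1}}$ for $x\in[1,a)$. For $c>0$, $D_c f(x)=\sqrt{c}\,f(cx)$. The dilation-and-modulation system is $\mathcal{MD}(\Psi,a)=\{\Lambda_m D_{a^j}\psi_l:\ m,j\in\mathbb{Z},\ 1\le l\le L\}$ (indexed by $(m,j,l)$). The $\Theta_a$-transform of $f\in L^2(\mathbb{R}_+)$ is $\Theta_a f(x,\xi)=\sum_{l\in\mathbb{Z}}a^{l/2}f(a^l x)e^{-2\pi i l\xi}$ for a.e. $(x,\xi)\in\mathbb{R}_+\times\mathbb{R}$ (for a.e. $x$ the coefficient sequence is in $\ell^2(\mathbb{Z})$,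 so the series is a Fourier series converging in $L^2([0,1))$ in $\xi$). $\mathcal{MD}(\Psi,a)$ is a Bessel sequence in $L^2(\mathbb{R}_+)$ with Bessel bound $B$ if $\sum_{l=1}^{L}\sum_{m,j\in\mathbb{Z}}|\langle f,\Lambda_m D_{a^j}\psi_l\rangle_{L^2(\mathbb{R}_+)}|^2\le B\|f\|_{L^2(\mathbb{R}_+)}^2$ for all $f\in L^2(\mathbb{R}_+)$; the bound is not required to be optimal. *)

(* Defs.v *)
From HB Require Import structures.
From mathcomp Require Import all_boot all_order all_algebra.
From mathcomp Require Import all_classical all_reals all_analysis.
From mathcomp.real_closed Require Import complex.

Set Implicit Arguments.
Unset Strict Implicit.
Unset Printing Implicit Defensive.

Import Order.TTheory GRing.Theory Num.Theory.
Import numFieldNormedType.Exports.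

Local Open Scope classical_set_scope.
Local Open Scope ring_scope.
Local Open Scope complex_scope.

Section defs.
Context {R : realType}.
Implicit Types (a c x xi B : R) (f g : R -> R[i]) (m j l : int).

Definition Rpos : set R := [set` `]0, +oo[%R].

(* The library has no measurable or integral structure on [R[i]]: both are
   taken componentwise.  Functions are Borel measurable; every L^2 class
   contains such a representative. *)
Definition cmeasurable d (T : measurableType d) (D : set T) (f : T -> R[i]) :=
  measurable_fun D (fun t => complex.Re (f t)) /\
  measurable_fun D (fun t => complex.Im (f t)).

Definition cintegral d (T : measurableType d) (mu : {measure set T -> \bar R})
    (D : set T) (f : T -> R[i]) : R[i] :=
  (\int[mu]_(t in D) complex.Re (f t)) +i* (\int[mu]_(t in D) complex.Im (f t)).

Definition cmod (z : R[i]) : R := ComplexField.Normc.normc z.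

Definition cexp_i (t : R) : R[i] := cos t +i* sin t.

Definition sqnorm f : \bar R :=
  (\int[lebesgue_measure]_(x in Rpos) ((cmod (f x)) ^+ 2)%:E)%E.

Definition L2 f := cmeasurable Rpos f /\ (sqnorm f < +oo)%E.

(* Equality of the classes of [f] and [g] in L^2(R_+). *)
Definition eqL2 f g := {ae lebesgue_measure, forall x, Rpos x -> f x = g x}.

Definition inner f g : R[i] :=
  cintegral lebesgue_measure Rpos (fun x => f x * conjc (g x)).

Definition dilation c f : R -> R[i] := fun x => (Num.sqrt c)%:C * f (c * x).

(* For a > 1 and x > 0, the unique a^k x (k : int) lying in [1, a). *)
Definition fold_dil a x : R := x * a ^ (- Num.floor (ln x / ln a)).

Definition Lambda a m : R -> R[i] := fun x =>
  (Num.sqrt (a - 1))^-1%:C * cexp_i (2 * pi * m%:~R * fold_dil a x / (a - 1)).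

Lemma Lambda_periodic a m x : 1 < a -> 0 < x ->
  Lambda a m (a * x) = Lambda a m x.
Proof.
move=> a1 x0; have a0 : 0 < a by apply: lt_trans a1.
have la : ln a != 0 by rewrite gt_eqF ?ln_gt0.
have E : ln (a * x) / ln a = ln x / ln a + 1.
  by rewrite lnM ?posrE// mulrDl divff// addrC.
suff e : fold_dil a (a * x) = fold_dil a x by rewrite /Lambda e.
rewrite /fold_dil E floorDrz ?rpred1// floor1 opprD.
by rewrite expfzDr ?gt_eqF// exprN1 [a * x]mulrC mulrAC -!mulrA mulVf ?gt_eqF ?mulr1.
Qed.

Lemma Lambda_itv a m x : 1 < a -> x \in `[1, a[ ->
  Lambda a m x =
    (Num.sqrt (a - 1))^-1%:C * cexp_i (2 * pi * m%:~R * x / (a - 1)).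
Proof.
move=> a1; rewrite in_itv/= => /andP[x1 xa].
have x0 : 0 < x by apply: lt_le_trans x1.
have la : 0 < ln a by rewrite ln_gt0.
rewrite /Lambda /fold_dil (_ : Num.floor _ = 0) ?oppr0 ?expr0z ?mulr1//.
apply: floor_def; apply/andP; split.
  by apply: divr_ge0; [exact: ln_ge0 | exact: ltW].
by rewrite add0r ltr_pdivrMr// mul1r ltr_ln ?posrE// (lt_trans _ a1).
Qed.

Definition MD L (psi : 'I_L -> R -> R[i]) a (m j : int) (l : 'I_L) : R -> R[i] :=
  fun x => Lambda a m x * dilation (a ^ j) (psi l) x.

Definition bessel_MD L (psi : 'I_L -> R -> R[i]) a B := forall f, L2 f ->
  (\sum_(l < L) \esum_(mj in [set: int * int])
      ((cmod (inner f (MD psi a mj.1 mj.2 l))) ^+ 2)%:E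
    <= B%:E * sqnorm f)%E.

Definition theta_psum a f (N : nat) x xi : R[i] :=
  \sum_(k < N.*2.+1) let l := k%:Z - N%:Z in
    (a `^ (l%:~R / 2))%:C * f (a ^ l * x) * cexp_i (- (2 * pi * l%:~R * xi)).

(* [F] represents the Theta_a-transform of [f]: it is jointly measurable,
   1-periodic in the second variable, and for a.e. x > 0 the symmetric partial
   sums of the Fourier series converge to F(x, .) in L^2([0,1)).  Joint
   measurability matters: choosing the L^2([0,1))-limit separately for each x
   would not determine a function a.e. on the product. *)
Definition is_theta a f (F : R * R -> R[i]) :=
  [/\ cmeasurable (Rpos `*` [set: R]) F,
      forall x xi, F (x, xi + 1) = F (x, xi) &
      {ae lebesgue_measure, forall x, Rpos x ->
        (fun N : nat => \int[lebesgue_measure]_(xi in [set` `[0%R, 1%R[])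
            ((cmod (F (x, xi) - theta_psum a f N x xi)) ^+ 2)%:E)%E
          @ \oo --> 0%E}].

(* A representative of the transform, which is determined up to a.e. equality;
   0 is a junk value, used only when [f] has no transform. *)
Definition Theta a f : R * R -> R[i] := xget (fun=> 0) [set F | is_theta a f F].

End defs.

(* Main.v *)
Require Import Defs.
From HB Require Import structures.
From mathcomp Require Import all_boot all_order all_algebra.
From mathcomp Require Import all_classical all_reals all_analysis.
From mathcomp.real_closed Require Import complex.
From mathcomp Require Import measurable_realfun.
From mathcomp Require Import ring lra zify.

Set Implicit Arguments.
Unset Strict Implicit.
Unset Printing Implicit Defensive.

Import Order.TTheory GRing.Theory Num.Theory.
Import numFieldNormedType.Exports.

Local Open Scope classical_set_scope.
Local Open Scope ring_scope.
Local Open Scope complex_scope.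

(** The transform turns the system into a system of exponentials times
    functions.  Write F_l for the transform of psi_l and Q = [1, a) x [0, 1) for
    the fundamental cell.  Dilating by a^j multiplies a transform by e(j xi), and
    multiplying by Lambda_m multiplies it by Lambda_m(x), because Lambda_m is
    constant on dilation orbits.  Over Q the transform is an isometry: on the
    fibre over x this is Parseval's identity for the sequence of normalized
    values of f on the orbit of x, and the dilates of [1, a) tile the half line.
    Hence ([synthesis_isometry]) the squared norm of a finite combination with
    coefficients c of the elements of the system is the integral over Q of
    |sum_l T_l F_l|^2, where T_l is the trigonometric polynomial with
    coefficients c(., ., l); and the integral over Q of sum_l |T_l|^2 is the
    square sum of c ([sqn_cell_poly]).

    By duality ([bessel_finite], [synthesis_bound_of_bessel]), the system is
    Bessel with bound B exactly when every finite combination has squared norm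
    at most B times the square sum of its coefficients.  The theorem therefore
    compares the pointwise bound sum_l |F_l|^2 <= B with the inequality
      (I)  integral of |sum_l T_l F_l|^2 <= B * integral of sum_l |T_l|^2
    for all families of trigonometric polynomials.

    The pointwise bound implies (I) by the Cauchy-Schwarz inequality in C^L
    ([bessel_of_bound]).  Conversely, choose T_l = z_l P(x) R(xi) with constants
    z_l and with P and R powers of (1 + e) / 2, whose square moduli concentrate
    at an arbitrary point.  Averaging over the position of this point and letting
    the degree grow bounds the integrals of |sum_l z_l F_l|^2 over intervals, so
    by Lebesgue differentiation |sum_l z_l F_l|^2 <= B sum_l |z_l|^2 almost
    everywhere ([ae_le_of_kernel_averages], used once in x and once in xi).
    Countably many z are dense in C^L, and z_l = conjugate of F_l gives the bound
    ([bound_of_bessel]).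

    The transform is specified by mean-square convergence on almost every fibre
    together with joint measurability, so its existence has to be shown
    ([theta_rep_is_theta]): partial sums are taken up to a rank that depends
    measurably on x and leaves a geometrically small remainder, so that they
    converge pointwise almost everywhere to a jointly measurable function. *)

(** * Complex-valued functions *)

Section complex_basics.
Context {R : realType}.
Implicit Types (z w : R[i]) (x y : R).

Lemma cmod2E z : cmod z ^+ 2 = complex.Re z ^+ 2 + complex.Im z ^+ 2.
Proof.
by case: z => x y; rewrite /cmod/= sqr_sqrtr// addr_ge0 ?sqr_ge0.
Qed.

Lemma cmod2_ge0 z : 0 <= cmod z ^+ 2.
Proof. exact: sqr_ge0. Qed.

Lemma cmod_ge0 z : 0 <= cmod z.
Proof. by case: z => x y; exact: sqrtr_ge0. Qed.

Lemma cmodM z w : cmod (z * w) = cmod z * cmod w.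
Proof. exact: ComplexField.Normc.normcM. Qed.

Lemma cmod0 : cmod (0 : R[i]) = 0.
Proof. exact: ComplexField.Normc.normc0. Qed.

Lemma cmod_real x : cmod x%:C ^+ 2 = x ^+ 2.
Proof. by rewrite cmod2E/= expr0n addr0. Qed.

Lemma cmodN z : cmod (- z) = cmod z.
Proof. exact: normcN. Qed.

Lemma cmodD z w : cmod (z + w) <= cmod z + cmod w.
Proof. exact: le_normcD. Qed.

Lemma cmod_conj z : cmod (conjc z) = cmod z.
Proof. by case: z => x y; rewrite /cmod/= sqrrN. Qed.

Lemma cReM z w : complex.Re (z * w) =
  complex.Re z * complex.Re w - complex.Im z * complex.Im w.
Proof. by case: z w => ? ? [? ?]. Qed.

Lemma cImM z w : complex.Im (z * w) =
  complex.Re z * complex.Im w + complex.Im z * complex.Re w.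
Proof. by case: z w => ? ? [? ?]. Qed.

Lemma cReD z w : complex.Re (z + w) = complex.Re z + complex.Re w.
Proof. by case: z w => ? ? [? ?]. Qed.

Lemma cImD z w : complex.Im (z + w) = complex.Im z + complex.Im w.
Proof. by case: z w => ? ? [? ?]. Qed.

Lemma cReN z : complex.Re (- z) = - complex.Re z.
Proof. by case: z. Qed.

Lemma cImN z : complex.Im (- z) = - complex.Im z.
Proof. by case: z. Qed.

Lemma cRe_sum I (r : seq I) (F : I -> R[i]) :
  complex.Re (\sum_(i <- r) F i) = \sum_(i <- r) complex.Re (F i).
Proof. by elim/big_rec2: _ => // i x z _ <-; rewrite cReD. Qed.

Lemma conjc_sum I (r : seq I) (F : I -> R[i]) :
  conjc (\sum_(i <- r) F i) = \sum_(i <- r) conjc (F i).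
Proof. exact: (raddf_sum (@conjc R)). Qed.

Lemma cmod2_conj z : (cmod z ^+ 2)%:C = z * conjc z.
Proof.
rewrite cmod2E; case: z => x y; apply/eqP.
by rewrite eq_complex/=; apply/andP; split; apply/eqP; ring.
Qed.

Lemma cmod2_Re z : cmod z ^+ 2 = complex.Re (z * conjc z).
Proof. by rewrite -cmod2_conj. Qed.

(** The weights make the cross term disappear by the inequality
    2 |z| |w| <= e |z|^2 + |w|^2 / e; letting e tend to 0 turns convergence in
    norm into convergence of norms, without any Cauchy-Schwarz inequality for
    integrals. *)
Lemma cmod2D_weighted (e : R) z w : 0 < e ->
  cmod (z + w) ^+ 2 <= (1 + e) * cmod z ^+ 2 + (1 + e^-1) * cmod w ^+ 2.
Proof.
move=> e0; rewrite !cmod2E cReD cImD; set a := complex.Re z.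
set b := complex.Re w; set c := complex.Im z; set d := complex.Im w.
have ee : e * e^-1 = 1 by rewrite mulfV ?gt_eqF.
have H x y : (x + y) ^+ 2 <= (1 + e) * x ^+ 2 + (1 + e^-1) * y ^+ 2.
  have := mulr_ge0 (ltW e0) (sqr_ge0 (x - e^-1 * y)).
  have -> : e * (x - e^-1 * y) ^+ 2 =
     e * x ^+ 2 - 2 * (e * e^-1) * x * y + (e * e^-1) * e^-1 * y ^+ 2 by ring.
  rewrite ee; nra.
have := H a b; have := H c d; lra.
Qed.

Lemma cexp_iD x y : cexp_i (x + y) = cexp_i x * cexp_i y.
Proof.
apply/eqP; rewrite eq_complex/= cosD sinD.
by apply/andP; split; apply/eqP; ring.
Qed.

Lemma cmod_cexp x : cmod (cexp_i x) ^+ 2 = 1.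
Proof. by rewrite cmod2E/= cos2Dsin2. Qed.

Lemma conjc_cexp x : conjc (cexp_i x) = cexp_i (- x).
Proof. by rewrite /cexp_i cosN sinN. Qed.

Lemma cexp_i_int (l : int) : cexp_i (2 * pi * l%:~R) = 1 :> R[i].
Proof.
have H (n : nat) : cexp_i (2 * pi * n%:R) = 1 :> R[i].
  elim: n => [|n ih]; first by rewrite mulr0 /cexp_i cos0 sin0.
  rewrite -[n.+1%:R]natr1 mulrDr cexp_iD ih mul1r mulr1 /cexp_i mulr_natl.
  by rewrite cos2pi sin2pi.
case: l => n; first exact: H.
rewrite NegzE mulrNz mulrN -conjc_cexp.
by rewrite (_ : _ *~ _ = n.+1%:R)// H; apply: conjc1.
Qed.

Lemma cos_measurable d (T : measurableType d) (D : set T) (f : T -> R) :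
  measurable_fun D f -> measurable_fun D (fun t => cos (f t)).
Proof.
by move=> mf; apply: (measurableT_comp _ mf); apply: continuous_measurable_fun;
  exact: continuous_cos.
Qed.

Lemma sin_measurable d (T : measurableType d) (D : set T) (f : T -> R) :
  measurable_fun D f -> measurable_fun D (fun t => sin (f t)).
Proof.
by move=> mf; apply: (measurableT_comp _ mf); apply: continuous_measurable_fun;
  exact: continuous_sin.
Qed.

Lemma le_Re_cmod z : `|complex.Re z| <= cmod z.
Proof.
by rewrite -(ler_sqr (x := `|_|)) ?nnegrE ?cmod_ge0// real_normK ?num_real//
  cmod2E lerDl sqr_ge0.
Qed.

Lemma le_Im_cmod z : `|complex.Im z| <= cmod z.
Proof.
by rewrite -(ler_sqr (x := `|_|)) ?nnegrE ?cmod_ge0// real_normK ?num_real//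
  cmod2E lerDr sqr_ge0.
Qed.

End complex_basics.

Section cmeasurable.
Context {R : realType} d (T : measurableType d).
Implicit Types (D : set T) (f g : T -> R[i]).

Lemma cmeasurableD D f g :
  cmeasurable D f -> cmeasurable D g -> cmeasurable D (fun t => f t + g t).
Proof.
move=> [f1 f2] [g1 g2]; split.
  by under eq_fun do rewrite cReD; exact: measurable_funD.
by under eq_fun do rewrite cImD; exact: measurable_funD.
Qed.

Lemma cmeasurableN D f : cmeasurable D f -> cmeasurable D (fun t => - f t).
Proof.
move=> [f1 f2]; split.
  by under eq_fun do rewrite cReN; exact: measurableT_comp.
by under eq_fun do rewrite cImN; exact: measurableT_comp.
Qed.

Lemma cmeasurableB D f g :
  cmeasurable D f -> cmeasurable D g -> cmeasurable D (fun t => f t - g t).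
Proof. by move=> mf mg; apply: cmeasurableD => //; exact: cmeasurableN. Qed.

Lemma cmeasurableM D f g :
  cmeasurable D f -> cmeasurable D g -> cmeasurable D (fun t => f t * g t).
Proof.
move=> [f1 f2] [g1 g2]; split.
  under eq_fun do rewrite cReM.
  by apply: measurable_funB; exact: measurable_funM.
under eq_fun do rewrite cImM.
by apply: measurable_funD; exact: measurable_funM.
Qed.

Lemma cmeasurable_cst D (z : R[i]) : cmeasurable D (fun=> z).
Proof. by split; exact: measurable_cst. Qed.

Lemma cmeasurable_conj D f : cmeasurable D f ->
  cmeasurable D (fun t => conjc (f t)).
Proof.
move=> [f1 f2]; split.
  by rewrite (_ : (fun _ => _) = fun t => complex.Re (f t))//;
    apply/funext => t; case: (f t).
rewrite (_ : (fun _ => _) = fun t => - complex.Im (f t));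
  first exact: measurableT_comp.
by apply/funext => t; case: (f t).
Qed.

Lemma cmeasurable_sum I (r : seq I) D (F : I -> T -> R[i]) :
  (forall i, cmeasurable D (F i)) ->
  cmeasurable D (fun t => \sum_(i <- r) F i t).
Proof.
move=> mF; elim: r => [|i r ih].
  by under eq_fun do rewrite big_nil; exact: cmeasurable_cst.
by under eq_fun do rewrite big_cons; exact: cmeasurableD.
Qed.

Lemma cmeasurable_cexp D (h : T -> R) :
  measurable_fun D h -> cmeasurable D (fun t => cexp_i (h t)).
Proof. by move=> mh; split; [exact: cos_measurable|exact: sin_measurable]. Qed.

Lemma cmeasurableS D E f : measurable E -> D `<=` E ->
  cmeasurable E f -> cmeasurable D f.
Proof. by move=> mE DE [f1 f2]; split; exact: measurable_funS DE _. Qed.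

Lemma cmeasurable_comp d' (T' : measurableType d') (E : set T') (h : T' -> R[i])
    D (u : T -> T') : measurable E -> (forall t, D t -> E (u t)) ->
  measurable_fun D u -> cmeasurable E h -> cmeasurable D (fun t => h (u t)).
Proof.
move=> mE DE mu [h1 h2].
have sub : u @` D `<=` E by move=> _ [t Dt <-]; exact: DE.
by split; [exact: (measurable_comp mE sub h1 mu)|exact: (measurable_comp mE sub
  h2 mu)].
Qed.

Lemma eq_cmeasurable D f g : (forall t, D t -> f t = g t) ->
  cmeasurable D f -> cmeasurable D g.
Proof.
move=> fg [f1 f2]; split.
  by apply: eq_measurable_fun f1 => t /set_mem/fg ->.
by apply: eq_measurable_fun f2 => t /set_mem/fg ->.
Qed.

Lemma measurable_cmod2 D f : cmeasurable D f ->
  measurable_fun D (fun t => cmod (f t) ^+ 2).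
Proof.
move=> [f1 f2]; under eq_fun do rewrite cmod2E.
by apply: measurable_funD; exact: measurable_funX.
Qed.

Lemma measurable_ecmod2 D f : cmeasurable D f ->
  measurable_fun D (fun t => (cmod (f t) ^+ 2)%:E).
Proof. by move=> mf; apply/measurable_EFinP; exact: measurable_cmod2. Qed.

End cmeasurable.

(** * Finite sums and trigonometric orthogonality *)

Section finite_cauchy_schwarz.
Context {R : realType} {I : Type}.
Implicit Types (r : seq I).

(** Lagrange's identity: the difference of the two sides is half the sum of all
    (u_i v_j - u_j v_i)^2. *)
Lemma sumr_cauchy_schwarz r (u v : I -> R) :
  (\sum_(i <- r) u i * v i) ^+ 2 <=
  (\sum_(i <- r) u i ^+ 2) * (\sum_(i <- r) v i ^+ 2).
Proof.
have : 0 <= \sum_(i <- r) \sum_(j <- r) (u i * v j - u j * v i) ^+ 2.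
  by apply: sumr_ge0 => i _; apply: sumr_ge0 => j _; exact: sqr_ge0.
under eq_bigr => i _.
  under eq_bigr => j _.
    rewrite (_ : _ ^+ 2 = u i ^+ 2 * v j ^+ 2 + v i ^+ 2 * u j ^+ 2
       - 2 * (u i * v i * (u j * v j))); last by ring.
    over.
  rewrite big_split /= big_split/= sumrN -!mulr_sumr.
  over.
rewrite big_split /= big_split/= sumrN -!mulr_sumr -!mulr_suml expr2.
by lra.
Qed.

Lemma cmod_sum r (F : I -> R[i]) :
  cmod (\sum_(i <- r) F i) <= \sum_(i <- r) cmod (F i).
Proof.
elim/big_rec2: _ => [|i x z _ ih]; first by rewrite cmod0.
by rewrite (le_trans (cmodD _ _))// lerD2l.
Qed.

Lemma cauchy_schwarz_sum r (z w : I -> R[i]) :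
  cmod (\sum_(i <- r) z i * w i) ^+ 2 <=
  (\sum_(i <- r) cmod (z i) ^+ 2) * (\sum_(i <- r) cmod (w i) ^+ 2).
Proof.
apply: le_trans (sumr_cauchy_schwarz _ _ _).
rewrite ler_sqr ?nnegrE ?cmod_ge0//; last first.
  by apply: sumr_ge0 => i _; rewrite mulr_ge0 ?cmod_ge0.
apply: (le_trans (cmod_sum _ _)); apply: ler_sum => i _; by rewrite cmodM.
Qed.

End finite_cauchy_schwarz.

Section trigonometric_orthogonality.
Context {R : realType}.
Local Notation mu := (@lebesgue_measure R).
Implicit Types (z : R[i]) (w x : R).
Variables (s b : R).
Hypothesis b0 : 0 < b.

Definition freq (k : int) (x : R) : R := 2 * pi * k%:~R * x / b.

Lemma freqD (k l : int) x : freq (k + l) x = freq k x + freq l x.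
Proof. by rewrite /freq intrD; ring. Qed.

Let tm (z : R[i]) (w x : R) := complex.Re (z * cexp_i (w * x)).
Let tp (z : R[i]) (w x : R) := w^-1 * complex.Im (z * cexp_i (w * x)).

Let tmE z w : tm z w = fun x => complex.Re z * cos (w * x) - complex.Im z * sin
  (w * x).
Proof. by apply/funext => x; rewrite /tm cReM. Qed.

Let tpE z w : tp z w = fun x =>
  w^-1 * (complex.Re z * sin (w * x) + complex.Im z * cos (w * x)).
Proof. by apply/funext => x; rewrite /tp cImM. Qed.

Let tp_derive z w x : w != 0 -> is_derive x (1:R) (tp z w) (tm z w x).
Proof.
move=> w0; rewrite tpE tmE.
have dw : is_derive x (1:R) (w \*: (@id R)) (w *: (1 : R)) by exact: is_deriveZ.
have ds := is_deriveZ (complex.Re z)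
  (@is_derive1_comp _ _ _ _ _ _ (is_derive_sin (w *: x)) dw).
have dc := is_deriveZ (complex.Im z)
  (@is_derive1_comp _ _ _ _ _ _ (is_derive_cos (w *: x)) dw).
apply: (is_derive_eq (is_deriveZ w^-1 (is_deriveD ds dc))).
by rewrite /GRing.scale/=; field.
Qed.

Let tm_cont z w : continuous (tm z w).
Proof.
rewrite tmE => x; apply: cvgB; apply: cvgM; try exact: cvg_cst.
  apply: continuous_comp; last exact: continuous_cos.
  by apply: cvgM; [exact: cvg_cst|exact: cvg_id].
apply: continuous_comp; last exact: continuous_sin.
by apply: cvgM; [exact: cvg_cst|exact: cvg_id].
Qed.

Let tm_integrable z w : mu.-integrable [set` `[s, s + b[] (EFin \o tm z w).
Proof.
have H : mu.-integrable [set` `[s, s + b]] (EFin \o tm z w).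
  apply: continuous_compact_integrable; first exact: segment_compact.
  by apply: continuous_subspaceT; exact: tm_cont.
by apply: integrableS H => //; exact: subset_itv_co_cc.
Qed.

Let tm_int z (k : int) :
  (\int[mu]_(x in [set` `[s, (s + b)%R[]) (tm z (2 * pi * k%:~R / b) x)%:E
   = (if k == 0 then b * complex.Re z else 0)%:E)%E.
Proof.
have [->|k0] := eqVneq k 0.
  rewrite mulr0 mul0r.
  under eq_integral do rewrite tmE mul0r cos0 sin0 mulr1 mulr0 subr0.
  rewrite integral_cst//= lebesgue_measure_itv/= lte_fin ltrDl b0.
  by rewrite -EFinD -EFinM; congr EFin; ring.
set w := _ / b; have w0 : w != 0.
  apply: mulf_neq0; last by rewrite invr_neq0// gt_eqF.
  apply: mulf_neq0; last by rewrite intr_eq0.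
  by rewrite mulf_neq0// gt_eqF// pi_gt0.
have mt : measurable_fun [set` `[s, s + b[] (tm z w).
  by apply: measurable_funTS; apply: continuous_measurable_fun; exact: tm_cont.
rewrite integral_itv_bndo_bndc; last by apply/measurable_EFinP.
have dtp x : derivable (tp z w) x 1 by apply: ex_derive; exact: tp_derive.
have ctp x : {for x, continuous (tp z w)}.
  by apply: differentiable_continuous; apply/derivable1_diffP.
rewrite (@continuous_FTC2 _ _ (tp z w)).
- rewrite -EFinB /tp mulrDr cexp_iD.
  rewrite (_ : w * b = 2 * pi * k%:~R); last by rewrite /w; field;
    rewrite gt_eqF.
  by rewrite cexp_i_int mulr1 subrr.
- by rewrite ltrDl.
- by apply: continuous_subspaceT; exact: tm_cont.
- split => //.
  + by apply: cvg_at_right_filter; exact: ctp.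
  + by apply: cvg_at_left_filter; exact: ctp.
- by move=> x _; rewrite derive1E; apply: derive_val; exact: tp_derive.
Qed.

(** Expanding the square leaves integrals of exponentials of frequency k - l,
    and an exponential of nonzero integer frequency has integral zero over a
    period. *)
Lemma trig_orthogonality (r : seq int) (c : int -> R[i]) : uniq r ->
  (\int[mu]_(x in [set` `[s, (s + b)%R[])
     (cmod (\sum_(k <- r) c k * cexp_i (freq k x)) ^+ 2)%:E
   = (b * \sum_(k <- r) cmod (c k) ^+ 2)%:E)%E.
Proof.
move=> ur.
pose w (k : int) := 2 * pi * k%:~R / b.
transitivity (\int[mu]_(x in [set` `[s, (s + b)%R[])
   \sum_(k <- r) \sum_(l <- r) (tm (c k * conjc (c l)) (w (k - l)) x)%:E)%E.
  apply: eq_integral => x _.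
  under [in RHS]eq_bigr do rewrite sumEFin.
  rewrite sumEFin; congr EFin.
  rewrite cmod2_Re conjc_sum mulr_suml cRe_sum; apply: eq_bigr => k _.
  rewrite mulr_sumr cRe_sum; apply: eq_bigr => l _.
  rewrite /tm (_ : w (k - l) * x = freq k x - freq l x); last first.
    by rewrite /w /freq intrB; ring.
  rewrite cexp_iD -conjc_cexp rmorphM/=; congr complex.Re; ring.
rewrite integral_sum//=; last first.
  by move=> k; apply: integrable_sum => // l _; exact: tm_integrable.
rewrite mulr_sumr -sumEFin; apply: eq_big_seq => k kr.
rewrite integral_sum//=; last by move=> l; exact: tm_integrable.
rewrite (bigD1_seq k)//= tm_int subrr eqxx -cmod2_Re big1 ?adde0// => l lk.
by rewrite tm_int subr_eq0 eq_sym (negbTE lk).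
Qed.

End trigonometric_orthogonality.

(** * Square norms and mean-square convergence *)

Section square_norm.
Context {R : realType} d (T : measurableType d).
Variables (mu : {measure set T -> \bar R}) (D : set T).
Hypothesis mD : measurable D.
Implicit Types (f g : T -> R[i]).

Definition sqn f : \bar R := (\int[mu]_(t in D) (cmod (f t) ^+ 2)%:E)%E.

Lemma sqn_ge0 f : (0 <= sqn f)%E.
Proof. by apply: integral_ge0 => t _; rewrite lee_fin cmod2_ge0. Qed.

Lemma eq_sqn f g : (forall t, D t -> f t = g t) -> sqn f = sqn g.
Proof. by move=> fg; apply: eq_integral => t /set_mem/fg ->. Qed.

Lemma le_sqn (k : R) f g : 0 <= k -> cmeasurable D f -> cmeasurable D g ->
  (forall t, D t -> cmod (f t) ^+ 2 <= k * cmod (g t) ^+ 2) ->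
  (sqn f <= k%:E * sqn g)%E.
Proof.
move=> k0 mf mg fg; rewrite /sqn -ge0_integralZl_EFin//.
- apply: ge0_le_integral => //.
  + by move=> t _; rewrite lee_fin cmod2_ge0.
  + exact: measurable_ecmod2.
  + apply/measurable_EFinP; apply: measurable_funM => //.
    exact: measurable_cmod2.
- by move=> t _; rewrite lee_fin cmod2_ge0.
- exact: measurable_ecmod2.
Qed.

Lemma sqnD_weighted (e : R) f g : 0 < e -> cmeasurable D f -> cmeasurable D g ->
  (sqn (fun t => (f t + g t)%R)
    <= (1 + e)%:E * sqn f + (1 + e^-1)%:E * sqn g)%E.
Proof.
move=> e0 mf mg; rewrite /sqn.
have e10 : 0 <= 1 + e by rewrite addr_ge0// ltW.
have e20 : 0 <= 1 + e^-1 by rewrite addr_ge0// invr_ge0 ltW.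
have ge0 h t : (0 <= (cmod (h t) ^+ 2)%:E)%E by rewrite lee_fin cmod2_ge0.
have mfe := measurable_ecmod2 mf; have mge := measurable_ecmod2 mg.
rewrite -!ge0_integralZl_EFin// -ge0_integralD//; last 4 first.
- by move=> t _; rewrite mule_ge0.
- exact: measurable_funeM.
- by move=> t _; rewrite mule_ge0.
- exact: measurable_funeM.
apply: ge0_le_integral => //.
- by apply: measurable_ecmod2; exact: cmeasurableD.
- by apply: emeasurable_funD; exact: measurable_funeM.
- by move=> t _; rewrite -!EFinM -EFinD lee_fin cmod2D_weighted.
Qed.

Lemma sqnD_le f g : cmeasurable D f -> cmeasurable D g ->
  (sqn (fun t => (f t + g t)%R) <= 2%:E * sqn f + 2%:E * sqn g)%E.
Proof.
move=> mf mg; have := sqnD_weighted (@ltr01 R) mf mg.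
by rewrite invr1.
Qed.

Lemma sqnN f : sqn (fun t => - f t) = sqn f.
Proof. by apply: eq_integral => t _; rewrite cmodN. Qed.

Lemma sqnB f g : sqn (fun t => f t - g t) = sqn (fun t => g t - f t).
Proof. by rewrite -sqnN; apply: eq_sqn => t _; rewrite opprB. Qed.

Definition cvgL2 (u : (T -> R[i])^nat) f :=
  [/\ forall n, cmeasurable D (u n), cmeasurable D f &
      sqn (fun t => u n t - f t) @[n --> \oo] --> 0%E].

Lemma squeeze_cvge0 (u v : (\bar R)^nat) : (forall n, (0 <= u n)%E) ->
  (forall n, (u n <= v n)%E) -> v @ \oo --> 0%E -> u @ \oo --> 0%E.
Proof.
move=> u0 uv v0; apply: (@squeeze_cvge _ _ _ _ (cst 0%E) _ v) => //.
  by apply: nearW => n; rewrite u0 uv.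
exact: cvg_cst.
Qed.

Lemma cvgL2D u v f g : cvgL2 u f -> cvgL2 v g ->
  cvgL2 (fun n t => u n t + v n t) (fun t => f t + g t).
Proof.
move=> [mu_ mf uf] [mv mg vg]; split.
- by move=> n; exact: cmeasurableD.
- exact: cmeasurableD.
apply: (@squeeze_cvge0 _ (fun n => 2%:E * sqn (fun t => (u n t - f t)%R)
   + 2%:E * sqn (fun t => (v n t - g t)%R)))%E.
- by move=> n; exact: sqn_ge0.
- move=> n; rewrite (_ : sqn _ = sqn (fun t => (u n t - f t) + (v n t - g t))).
    by apply: sqnD_le; exact: cmeasurableB.
  by apply: eq_sqn => t _; ring.
rewrite -(adde0 0%E) -[X in (X + _)%E](mule0 2%:E) -[X in (_
  + X)%E](mule0 2%:E).
by apply: cvgeD => //; apply: cvgeZl.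
Qed.

Lemma cvgL2_cst f : cmeasurable D f -> cvgL2 (fun=> f) f.
Proof.
move=> mf; split => //.
rewrite (_ : (fun _ => _) = cst 0%E); first exact: cvg_cst.
apply/funext => n; rewrite /sqn integral0_eq// => t _.
by rewrite subrr cmod0 expr0n.
Qed.

Lemma cvgL2_sum I (r : seq I) (u : I -> (T -> R[i])^nat) (f : I -> T -> R[i]) :
  (forall i, cvgL2 (u i) (f i)) ->
  cvgL2 (fun n t => \sum_(i <- r) u i n t) (fun t => \sum_(i <- r) f i t).
Proof.
move=> H; elim: r => [|i r ih].
  under eq_fun do under eq_fun do rewrite big_nil.
  by under [X in cvgL2 _ X]eq_fun do rewrite big_nil; apply: cvgL2_cst;
    exact: cmeasurable_cst.
under eq_fun do under eq_fun do rewrite big_cons.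
under [X in cvgL2 _ X]eq_fun do rewrite big_cons.
exact: cvgL2D.
Qed.

Lemma cvgL2M (k : R) (h : T -> R[i]) u f : cmeasurable D h ->
  (forall t, D t -> cmod (h t) ^+ 2 <= k) ->
  cvgL2 u f -> cvgL2 (fun n t => h t * u n t) (fun t => h t * f t).
Proof.
move=> mh hk [mu_ mf uf]; split.
- by move=> n; exact: cmeasurableM.
- exact: cmeasurableM.
have hk' t : D t -> cmod (h t) ^+ 2 <= `|k|.
  by move=> /hk/le_trans; apply; exact: ler_norm.
apply: (@squeeze_cvge0 _ (fun n => `|k|%:E * sqn (fun t => (u n t - f t)%R)))%E.
- by move=> n; exact: sqn_ge0.
- move=> n; apply: le_sqn => //.
  + by apply: cmeasurableB => //; exact: cmeasurableM.
  + exact: cmeasurableB.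
  + move=> t Dt; rewrite -mulrBr cmodM exprMn ler_wpM2r ?hk'//.
    exact: cmod2_ge0.
by rewrite -(mule0 `|k|%:E); apply: cvgeZl.
Qed.

End square_norm.

Section norm_limits.
Context {R : realType} d1 d2 (X : measurableType d1) (Y : measurableType d2).
Variables (mu : {measure set X -> \bar R}) (nu : {measure set Y -> \bar R}).
Variables (A : set X) (B : set Y).
Hypotheses (mA : measurable A) (mB : measurable B).

(** Two uses of the weighted inequality give, for every e > 0 and every n,
    |f|^2 <= (1 + e)^2 |g|^2 plus multiples of |u_n - f|^2 and |v_n - g|^2, and
    these vanish as n grows.  Comparing sequences that live on two different
    spaces is what extends an isometry from a dense class. *)
Lemma cvgL2_le_norm u f v g : cvgL2 mu A u f -> cvgL2 nu B v g ->
  (forall n, sqn mu A (u n) = sqn nu B (v n)) -> (sqn mu A f <= sqn nu B g)%E.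
Proof.
move=> [mu_ mf uf] [mv mg vg] uv.
have [gfin|] := boolP (sqn nu B g \is a fin_num); last first.
  by rewrite ge0_fin_numE ?sqn_ge0// -leNgt leye_eq => /eqP ->; exact: leey.
have step (e : R) : 0 < e ->
    (sqn mu A f <= ((1 + e) ^+ 2)%:E * sqn nu B g)%E.
  move=> e0.
  have e10 : 0 <= 1 + e by rewrite addr_ge0// ltW.
  have e20 : 0 <= 1 + e^-1 by rewrite addr_ge0// invr_ge0 ltW.
  pose b n := (((1 + e) ^+ 2)%:E * sqn nu B g +
     (((1 + e) * (1 + e^-1))%:E * sqn nu B (fun t => (v n t - g t)%R) +
     (1 + e^-1)%:E * sqn mu A (fun t => (u n t - f t)%R)))%E.
  have bl : b @ \oo --> (((1 + e) ^+ 2)%:E * sqn nu B g)%E.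
    rewrite -[X in _ --> X]adde0 -[X in (_ + X)%E]adde0.
    rewrite -[X in (_ + (X + _))%E](mule0 ((1 + e) * (1 + e^-1))%:E).
    rewrite -[X in (_ + (_ + X))%E](mule0 (1 + e^-1)%:E).
    apply: cvgeD; first by rewrite fin_num_adde_defr// fin_numM.
      exact: cvg_cst.
    by apply: cvgeD; [rewrite !mule0|exact: cvgeZl|exact: cvgeZl].
  apply: (cvge_to_ge bl); apply: nearW => n.
  rewrite (_ : sqn mu A f = sqn mu A (fun t => u n t + (f t - u n t)));
    last first.
    by apply: eq_sqn => t _; ring.
  apply: le_trans; first exact: (sqnD_weighted _ mA e0 (mu_ n) (cmeasurableB mf
    (mu_ n))).
  rewrite sqnB uv /b addeA; apply: leeD => //.
  rewrite (_ : sqn nu B (v n) = sqn nu B (fun t => g t + (v n t - g t)));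
    last first.
    by apply: eq_sqn => t _; ring.
  apply: (le_trans (lee_wpmul2l _ (sqnD_weighted _ mB e0 mg (cmeasurableB (mv
    n) mg)))).
    by rewrite lee_fin.
  rewrite ge0_muleDr; last 2 first.
    by rewrite mule_ge0 ?sqn_ge0// lee_fin.
    by rewrite mule_ge0 ?sqn_ge0// lee_fin.
  by rewrite !muleA -!EFinM.
rewrite -(fineK gfin) in step *; set G := fine _ in step *.
have G0 : 0 <= G by apply: fine_ge0; exact: sqn_ge0.
apply/lee_addgt0Pr => e e0.
have k0 : 0 < e / (3 * G + e + 1) by rewrite divr_gt0//; nra.
apply: (le_trans (step _ k0)); rewrite -EFinM -EFinD lee_fin.
set k := e / _ in k0 *.
have k1 : k <= 1 by rewrite /k ler_pdivrMr ?mul1r; nra.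
have kG : 3 * k * G <= e.
  have : k * (3 * G + e + 1) = e by rewrite /k divfK// gt_eqF//; nra.
  nra.
nra.
Qed.

End norm_limits.

Lemma cvgL2_eq_norm {R : realType} d1 d2 (X : measurableType d1)
    (Y : measurableType d2) (mu : {measure set X -> \bar R})
    (nu : {measure set Y -> \bar R}) A B u f v g :
  measurable A -> measurable B -> cvgL2 mu A u f -> cvgL2 nu B v g ->
  (forall n, sqn mu A (u n) = sqn nu B (v n)) -> sqn mu A f = sqn nu B g.
Proof.
move=> mA mB uf vg uv; apply/eqP; rewrite eq_le.
rewrite (cvgL2_le_norm mA mB uf vg uv)/=.
by apply: (cvgL2_le_norm mB mA vg uf) => n; rewrite uv.
Qed.

(** * Dilations, rectangles and null sets *)

Section lebesgue_dilation.
Context {R : realType}.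
Local Notation mu := (@lebesgue_measure R).

Lemma dilate_measurable (c : R) : measurable_fun setT (fun x : R => c * x).
Proof. exact: mulrl_measurable. Qed.

Definition dilated_lebesgue (c : R) : {measure set (measurableTypeR R) ->
  \bar R}.
Proof.
refine (pushforward mu (fun x : R => c * x : measurableTypeR R)).
exact: dilate_measurable.
Defined.

Definition scaled_pushforward (c : R) (c0 : 0 < c) :=
  mscale (NngNum (ltW c0)) (dilated_lebesgue c).

Lemma preimage_dilate_itv (c s t : R) b1 b2 : 0 < c ->
  (fun x => c * x) @^-1` [set` Interval (BSide b1 (c * s)) (BSide b2 (c * t))] =
  [set` Interval (BSide b1 s) (BSide b2 t)].
Proof.
move=> c0; apply/seteqP; split => x /=; rewrite !in_itv/=.
  by rewrite lteif_pM2l// lteif_pM2l.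
by rewrite lteif_pM2l// lteif_pM2l.
Qed.

(** Both sides are measures, so it suffices to compare them on intervals. *)
Lemma lebesgue_measure_dilate (c : R) (A : set R) : 0 < c -> measurable A ->
  mu A = (c%:E * mu ((fun x => (c * x)%R) @^-1` A))%E.
Proof.
move=> c0 mA.
rewrite (_ : (_ * _)%E = scaled_pushforward c0 A)//.
apply: lebesgue_measure_unique => //= _ [[s t]] _ <-.
rewrite /scaled_pushforward/= /mscale/= /pushforward.
have -> : (s = c * (s / c))%R by rewrite mulrC divfK// gt_eqF.
have -> : (t = c * (t / c))%R by rewrite mulrC divfK// gt_eqF.
rewrite preimage_dilate_itv// !lebesgue_measure_itv/=.
rewrite !lte_fin ltr_pM2l//; case: ifPn => _; last by rewrite mule0.
by rewrite -!EFinD -EFinM; congr EFin; ring.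
Qed.

Lemma ge0_integral_dilate (c : R) (D : set R) (f : R -> \bar R) : 0 < c ->
  measurable D -> measurable_fun D f -> (forall x, D x -> 0 <= f x)%E ->
  (\int[mu]_(x in D) f x =
   c%:E * \int[mu]_(x in (fun x => (c * x)%R) @^-1` D) f (c * x)%R)%E.
Proof.
move=> c0 mD mf f0.
rewrite (eq_measure_integral (scaled_pushforward c0)); last first.
  by move=> A mA _; exact: lebesgue_measure_dilate.
rewrite ge0_integral_mscale//= ge0_integral_pushforward//.
  exact: dilate_measurable.
by move=> y /set_mem/f0.
Qed.

End lebesgue_dilation.

Section rectangles.
Local Open Scope ereal_scope.
Context {R : realType} d1 d2 (X : measurableType d1) (Y : measurableType d2).
Variables (mu : {sigma_finite_measure set X -> \bar R}).
Variables (nu : {sigma_finite_measure set Y -> \bar R}).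
Variables (A : set X) (B : set Y).
Hypotheses (mA : measurable A) (mB : measurable B).
Variable f : X * Y -> \bar R.
Hypotheses (mf : measurable_fun (A `*` B) f).
Hypothesis f0 : forall p, (A `*` B) p -> 0 <= f p.

Let mAB : measurable (A `*` B). Proof. exact: measurableX. Qed.
Let mF : measurable_fun setT (f \_ (A `*` B)).
Proof. exact/(measurable_restrictT _ mAB). Qed.
Let F0 p : 0 <= (f \_ (A `*` B)) p.
Proof. by rewrite patchE; case: ifPn => // /set_mem/f0. Qed.

Let inner_restrict x :
  \int[nu]_y (f \_ (A `*` B)) (x, y) = ((fun x => \int[nu]_(y in B) f (x,
    y)) \_ A) x.
Proof.
rewrite [RHS]patchE; case: ifPn => xA.
  rewrite [RHS]integral_mkcond; apply: eq_integral => y _.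
  by rewrite !patchE in_setX/= xA.
by rewrite integral0_eq// => y _; rewrite patchE in_setX/= (negbTE xA).
Qed.

(** The transform is only constrained over the half line, so Tonelli's theorem is
    applied to the extension by zero of a function defined on a rectangle. *)
Lemma tonelli_rect :
  \int[mu \x nu]_(p in A `*` B) f p = \int[mu]_(x in A) \int[nu]_(y in B) f (x,
    y).
Proof.
rewrite integral_mkcond fubini_tonelli1//= [RHS]integral_mkcond.
by apply: eq_integral => x _; rewrite -inner_restrict.
Qed.

Lemma measurable_inner_integral :
  measurable_fun A (fun x => \int[nu]_(y in B) f (x, y)).
Proof.
apply/(measurable_restrictT _ mA).
under [X in measurable_fun _ X]funext do rewrite -inner_restrict.
exact: measurable_fun_fubini_tonelli_F.
Qed.

End rectangles.

Section rectangles_swap.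
Local Open Scope ereal_scope.
Context {R : realType} d1 d2 (X : measurableType d1) (Y : measurableType d2).
Variables (mu : {sigma_finite_measure set X -> \bar R}).
Variables (nu : {sigma_finite_measure set Y -> \bar R}).
Variables (A : set X) (B : set Y).
Hypotheses (mA : measurable A) (mB : measurable B).

Lemma tonelli_swap (f : X * Y -> \bar R) : measurable_fun (A `*` B) f ->
  (forall p, (A `*` B) p -> 0 <= f p) ->
  \int[mu]_(x in A) \int[nu]_(y in B) f (x, y) =
  \int[nu]_(y in B) \int[mu]_(x in A) f (x, y).
Proof.
move=> mf f0.
have mAB : measurable (A `*` B) by exact: measurableX.
have mF : measurable_fun setT (f \_ (A `*` B))
  by exact/(measurable_restrictT _ mAB).
have F0 p : 0 <= (f \_ (A `*` B)) p.
  by rewrite patchE; case: ifPn => // /set_mem/f0.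
have H := fubini_tonelli (m1 := mu) (m2 := nu) _ mF F0.
rewrite [LHS]integral_mkcond [RHS]integral_mkcond.
transitivity (\int[mu]_x \int[nu]_y (f \_ (A `*` B)) (x, y)).
  apply: eq_integral => x _; rewrite patchE; case: ifPn => xA.
    rewrite [LHS]integral_mkcond; apply: eq_integral => y _.
    by rewrite !patchE in_setX/= xA.
  by rewrite integral0_eq// => y _; rewrite patchE in_setX/= (negbTE xA).
rewrite H; apply: eq_integral => y _; rewrite [in RHS]patchE; case: ifPn => yB.
  rewrite [RHS]integral_mkcond; apply: eq_integral => x _.
  by rewrite !patchE in_setX/= yB andbT.
by rewrite integral0_eq// => x _; rewrite patchE in_setX/= (negbTE yB) andbF.
Qed.

(** The measure of the exceptional set is the integral of the measures of its
    sections, almost all of which are null. *)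
Lemma ae_rect (P : X * Y -> Prop) :
  measurable ((A `*` B) `&` [set p | ~ P p]) ->
  {ae mu, forall x, A x -> {ae nu, forall y, B y -> P (x, y)}} ->
  {ae (mu \x nu), forall p, (A `*` B) p -> P p}.
Proof.
move=> mP [N [mN N0 NP]].
set E := _ `&` _ in mP.
exists E; split => //; last first.
  by move=> p /= /not_implyP[ABp nPp]; split.
rewrite /product_measure1/=.
transitivity (\int[mu]_x (nu (xsection E x))); first by [].
rewrite (ae_eq_integral (cst 0))//; first by rewrite integral0.
- exact: measurable_fun_xsection.
- exists N; split => // x /= nx; apply: NP => /= H; apply: nx => _.
  have [xA|xA] := pselect (A x); last first.
    rewrite (_ : xsection E x = set0) ?measure0//.
    by apply/seteqP; split => // y; rewrite /xsection/= inE => -[[]].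
  have [M [mM M0 MP]] := H xA.
  apply/eqP; rewrite eq_le measure_ge0 andbT -M0; apply: le_measure;
    rewrite ?inE//.
    exact: measurable_xsection.
  move=> y; rewrite /xsection/= inE => -[[_ By] nP]; apply: MP => /= /(_ By).
  exact: nP.
Qed.

End rectangles_swap.

Section almost_everywhere_combinators.
Context {R : realType} d (T : measurableType d).
Variable mu : {measure set T -> \bar R}.

Lemma ae_imp (P Q : T -> Prop) : (forall x, P x -> Q x) ->
  {ae mu, forall x, P x} -> {ae mu, forall x, Q x}.
Proof.
move=> PQ [N [mN N0 NP]]; exists N; split => // x nQ; apply: NP => Px.
by apply: nQ; exact: PQ.
Qed.

Lemma ae_imp2 (P Q S : T -> Prop) : (forall x, P x -> Q x -> S x) ->
  {ae mu, forall x, P x} -> {ae mu, forall x, Q x} -> {ae mu, forall x, S x}.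
Proof.
move=> PQS [M [mM M0 MP]] [N [mN N0 NP]].
exists (M `|` N); split; first exact: measurableU.
  by rewrite measureU0.
move=> x nS; have [Px|nP] := pselect (P x); last by left; exact: MP.
by right; apply: NP => Qx; apply: nS; exact: PQS.
Qed.

Lemma ae_forall_count (I : countType) (P : I -> T -> Prop) :
  (forall i, {ae mu, forall x, P i x}) -> {ae mu, forall x, forall i, P i x}.
Proof.
move=> aeP.
have : {ae mu, forall x (n : nat),
  if unpickle n is Some i then P i x else True}.
  apply/ae_foralln => n; case: (unpickle n) => [i|]; first exact: aeP.
  exact: aeW.
by apply: ae_imp => x H i; have := H (pickle i); rewrite pickleK.
Qed.

End almost_everywhere_combinators.

(** * Dilation orbits and their energy *)

Section symmetric_range.

Definition irange (N : nat) : seq int :=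
  [seq k%:Z - N%:Z | k <- iota 0 N.*2.+1].

Lemma irange_uniq N : uniq (irange N).
Proof. by rewrite map_inj_uniq ?iota_uniq// => k l /addIr[]. Qed.

Lemma mem_irange N (l : int) : (l \in irange N) = (`|l| <= N%:Z).
Proof.
apply/mapP/idP => [[k]|].
  rewrite mem_iota add0n ltnS -muln2 => /andP[_ k2] ->.
  by rewrite ler_norml; lia.
rewrite ler_norml => /andP[l1 l2]; exists (absz (l + N%:Z)).
  by rewrite mem_iota; lia.
by lia.
Qed.

Lemma irangeS N : irange N.+1 = (- N.+1%:Z) :: rcons (irange N) N.+1%:Z.
Proof.
rewrite /irange.
have -> : iota 0 N.+1.*2.+1 = 0%N :: rcons (map succn (iota 0 N.*2.+1)) N.*2.+2.
  rewrite doubleS -[N.*2.+3]/(1 + N.*2.+2)%N iotaD -cats1 -[iota 0 1]/[:: 0%N].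
  by rewrite -[N.*2.+2]addn1 iotaD -(iotaDl 1 0) [(N.*2.+1 + 1)%N]addn1.
rewrite map_cons map_rcons -map_comp sub0r; congr cons.
congr rcons; last by rewrite -addnn; lia.
by apply: eq_map => k /=; lia.
Qed.

End symmetric_range.

Section fourier_parseval.
Context {R : realType}.
Local Notation mu := (@lebesgue_measure R).

Definition fmode (l : int) (xi : R) : R[i] := cexp_i (- (2 * pi * l%:~R * xi)).

Lemma fmode_freq l xi : fmode l xi = cexp_i (freq 1 (- l) xi).
Proof. by rewrite /fmode /freq divr1 mulrNz mulrN mulNr. Qed.

Lemma fmodeD k l xi : fmode (k + l) xi = fmode k xi * fmode l xi.
Proof. by rewrite !fmode_freq opprD freqD cexp_iD. Qed.

Lemma cmod_fmode l xi : cmod (fmode l xi) ^+ 2 = 1.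
Proof. exact: cmod_cexp. Qed.

Lemma fmode_period l xi : fmode l (xi + 1) = fmode l xi.
Proof.
rewrite /fmode mulrDr opprD cexp_iD mulr1.
have -> : - (2 * pi * l%:~R) = 2 * pi * (- l)%:~R :> R by rewrite mulrNz mulrN.
by rewrite cexp_i_int mulr1.
Qed.

Lemma fmode_measurable l d (T : measurableType d) (D : set T) (h : T -> R) :
  measurable_fun D h -> cmeasurable D (fun t => fmode l (h t)).
Proof.
by move=> mh; apply: cmeasurable_cexp; apply: measurableT_comp => //;
  exact: measurable_funM.
Qed.

Lemma fourier_parseval (r : seq int) (h : int -> R[i]) : uniq r ->
  (\int[mu]_(xi in [set` `[0%R, 1%R[])
     (cmod (\sum_(l <- r) h l * fmode l xi) ^+ 2)%:E
   = (\sum_(l <- r) cmod (h l) ^+ 2)%:E)%E.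
Proof.
move=> ur; have := @trig_orthogonality R 0 1 ltr01 (map -%R r) (fun l => h (-
  l)).
rewrite map_inj_uniq; last exact: oppr_inj.
move=> /(_ ur); rewrite add0r big_map mul1r.
under [in X in _ -> X]eq_bigr do rewrite -[X in h X]opprK.
move=> <-; apply: eq_integral => xi _; rewrite big_map.
by under [in RHS]eq_bigr do rewrite opprK -fmode_freq.
Qed.

End fourier_parseval.

Section dilation_coefficients.
Context {R : realType}.
Local Notation mu := (@lebesgue_measure R).
Variable a : R.
Hypothesis a1 : 1 < a.
Implicit Types (f : R -> R[i]) (x s : R) (l : int) (N : nat).

Let a0 : 0 < a. Proof. exact: lt_trans a1. Qed.

(** The l-th Fourier coefficient of the transform on the fibre over x: the value
    of f on the dilation orbit of x, normalized so that dilations are unitary. *)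
Definition coef f l x : R[i] := (a `^ (l%:~R / 2))%:C * f (a ^ l * x).

Lemma theta_psumE f N x xi :
  theta_psum a f N x xi = \sum_(l <- irange N) coef f l x * fmode l xi.
Proof.
rewrite /theta_psum /irange big_map -(subn0 N.*2.+1) -/(index_iota 0 _).
by rewrite big_mkord.
Qed.

Lemma cmod_coef f l x : cmod (coef f l x) ^+ 2
  = a ^ l * cmod (f (a ^ l * x)) ^+ 2.
Proof.
rewrite cmodM exprMn cmod_real; congr (_ * _).
rewrite expr2 -powRD; last by rewrite (gt_eqF a0) implybT.
by rewrite -splitr powR_intmul// ltW.
Qed.

Lemma dilate_pos l x : 0 < x -> 0 < a ^ l * x.
Proof. by move=> x0; rewrite mulr_gt0// exprz_gt0. Qed.

Lemma Rpos_gt0 x : Rpos x <-> 0 < x.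
Proof. by rewrite /Rpos/= in_itv/= andbT. Qed.

Lemma measurable_Rpos : measurable (@Rpos R).
Proof. exact: measurable_itv. Qed.

Lemma coef_measurable f l : cmeasurable Rpos f -> cmeasurable Rpos (coef f l).
Proof.
move=> mf; apply: cmeasurableM; first exact: cmeasurable_cst.
apply: (cmeasurable_comp (E := Rpos)) => //.
- exact: measurable_Rpos.
- by move=> x /Rpos_gt0 x0; apply/Rpos_gt0; exact: dilate_pos.
Qed.

Definition energy f N x : R := \sum_(l <- irange N) cmod (coef f l x) ^+ 2.

Lemma energyS f N x : energy f N.+1 x = energy f N x +
  (cmod (coef f (- N.+1%:Z) x) ^+ 2 + cmod (coef f N.+1%:Z x) ^+ 2).
Proof. by rewrite /energy irangeS big_cons big_rcons/=; ring. Qed.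

Lemma energy_ge0 f N x : 0 <= energy f N x.
Proof. by apply: sumr_ge0 => l _; exact: cmod2_ge0. Qed.

Lemma le_energy f x : {homo energy f ^~ x : M N / (M <= N)%N >-> M <= N}.
Proof.
apply: homo_leq => [//|y u v|N]; first exact: le_trans.
by rewrite energyS lerDl addr_ge0// cmod2_ge0.
Qed.

Lemma energy_measurable f N : cmeasurable Rpos f ->
  measurable_fun Rpos (fun x => (energy f N x)%:E).
Proof.
move=> mf; apply/measurable_EFinP; apply: measurable_sum => l.
exact/measurable_cmod2/coef_measurable.
Qed.

(** The change of variables x -> a^l x carries the fundamental domain [s, a s)
    to [a^l s, a^(l+1) s), and these intervals tile (0, +oo). *)
Lemma integral_coef f l s : 0 < s -> cmeasurable Rpos f ->
  (\int[mu]_(x in [set` `[s, (a * s)%R[]) (cmod (coef f l x) ^+ 2)%:E =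
   \int[mu]_(x in [set` `[(a ^ l * s)%R, (a ^ (l + 1) * s)%R[])
     (cmod (f x) ^+ 2)%:E)%E.
Proof.
move=> s0 mf; have al0 : 0 < a ^ l by rewrite exprz_gt0.
rewrite [RHS](@ge0_integral_dilate _ (a ^ l))//; last 2 first.
- apply: measurable_ecmod2; apply: (cmeasurableS _ _ mf);
  first exact: measurable_Rpos.
  move=> x /=; rewrite in_itv/= => /andP[+ _] => sx; apply/Rpos_gt0.
  by apply: lt_le_trans sx; exact: dilate_pos.
- by move=> x _; rewrite lee_fin cmod2_ge0.
rewrite expfzDr ?gt_eqF// expr1z -mulrA preimage_dilate_itv//.
rewrite -ge0_integralZl_EFin//; last 3 first.
- by move=> x _; rewrite lee_fin cmod2_ge0.
- apply: measurable_ecmod2; apply: (cmeasurable_comp measurable_Rpos) mf.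
    move=> x /=; rewrite in_itv/= => /andP[sx _]; apply/Rpos_gt0/dilate_pos.
    exact: lt_le_trans sx.
  exact: measurable_funM.
- exact: ltW.
by apply: eq_integral => x _; rewrite cmod_coef EFinM.
Qed.

Lemma integral_energy f N s : 0 < s -> cmeasurable Rpos f ->
  (\int[mu]_(x in [set` `[s, (a * s)%R[]) (energy f N x)%:E =
   \int[mu]_(x in [set` `[(a ^ (- N%:Z) * s)%R, (a ^ (N.+1%:Z) * s)%R[])
     (cmod (f x) ^+ 2)%:E)%E.
Proof.
move=> s0 mf.
pose I (u v : R) := (\int[mu]_(x in [set` `[u, v[]) (cmod (f x) ^+ 2)%:E)%E.
have split u v w : 0 < u -> u <= v -> v <= w -> I u w = (I u v + I v w)%E.
  move=> u0 uv vw; rewrite /I (@itv_bndbnd_setU _ _ _ (BLeft v))//=.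
  rewrite ge0_integral_setU//.
  - apply: measurable_ecmod2; apply: (cmeasurableS _ _ mf);
    first exact: measurable_Rpos.
    move=> x /= [|]; rewrite in_itv/= => /andP[ux _]; apply/Rpos_gt0.
      exact: lt_le_trans ux.
    by apply: lt_le_trans ux; exact: lt_le_trans uv.
  - by move=> x _; rewrite lee_fin cmod2_ge0.
  - apply/disj_setPS => x [/=]; rewrite !in_itv/= => /andP[_ xv] /andP[vx _].
    by move: xv; rewrite ltNge vx.
have lem (k l : int) : (k <= l)%R -> a ^ k * s <= a ^ l * s.
  by move=> kl; rewrite ler_wpM2r ?(ltW s0)// ler_weXz2l// ltW.
under eq_integral do rewrite /energy -sumEFin.
have sub (x : R) : `[s, (a * s)%R[%classic x -> Rpos x.
  by move=> /=; rewrite in_itv/= => /andP[sx _]; apply/Rpos_gt0;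
    exact: lt_le_trans sx.
rewrite ge0_integral_sum//; last 2 first.
- move=> l; apply: measurable_ecmod2;
  apply: (cmeasurableS _ _ (coef_measurable _ mf)) => //.
  exact: measurable_Rpos.
- by move=> l x _; rewrite lee_fin cmod2_ge0.
under eq_bigr do rewrite integral_coef//.
rewrite -!/(I _ _).
elim: N => [|N ih].
  by rewrite /irange/= big_seq1.
rewrite irangeS big_cons big_rcons/= ih -/(I _ _).
rewrite [RHS](@split _ (a ^ (- N%:Z) * s)); last 3 first.
- exact: dilate_pos.
- by apply: lem; lia.
- by apply: lem; lia.
have -> : - N.+1%:Z + 1 = - N%:Z by lia.
have -> : N.+1%:Z + 1 = N.+2%:Z by lia.
congr (_ + _)%E.
rewrite [RHS](@split _ (a ^ (N.+1%:Z) * s)); last 3 first.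
- exact: dilate_pos.
- by apply: lem; lia.
- by apply: lem; lia.
by [].
Qed.

Lemma integral_energy_le f N s : 0 < s -> cmeasurable Rpos f ->
  (\int[mu]_(x in [set` `[s, (a * s)%R[]) (energy f N x)%:E <= sqnorm f)%E.
Proof.
move=> s0 mf; rewrite integral_energy// /sqnorm;
  apply: ge0_subset_integral => //.
- exact: measurable_Rpos.
- exact: measurable_ecmod2.
- by move=> x _; rewrite lee_fin cmod2_ge0.
- move=> x /=; rewrite in_itv/= => /andP[sx _]; apply/Rpos_gt0.
  by apply: lt_le_trans sx; exact: dilate_pos.
Qed.

(** Convergence of the transform on the fibre over x is governed by the square
    sum of the whole orbit of x, approached here through its symmetric partial
    sums. *)
Definition total_energy f x : \bar R := limn (fun N => (energy f N x)%:E).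

Lemma energy_cvg f x : (energy f N x)%:E @[N --> \oo] --> total_energy f x.
Proof.
apply: ereal_nondecreasing_is_cvgn => M N MN.
by rewrite lee_fin le_energy.
Qed.

Lemma energy_le_total f N x : ((energy f N x)%:E <= total_energy f x)%E.
Proof.
apply: (cvge_to_ge (energy_cvg (f := f) (x := x))).
by exists N => // M /= NM; rewrite lee_fin le_energy.
Qed.

Lemma total_energy_ge0 f x : (0 <= total_energy f x)%E.
Proof. by apply: le_trans (energy_le_total f 0 x);
  rewrite lee_fin energy_ge0. Qed.

Lemma total_energy_measurable f : cmeasurable Rpos f ->
  measurable_fun Rpos (total_energy f).
Proof.
move=> mf; apply: (emeasurable_fun_cvg (fun N x => (energy f N x)%:E)).
  by move=> N; exact: energy_measurable.
by move=> x _; exact: energy_cvg.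
Qed.

Lemma integral_total_energy_le f s : 0 < s -> cmeasurable Rpos f ->
  (\int[mu]_(x in [set` `[s, (a * s)%R[]) total_energy f x <= sqnorm f)%E.
Proof.
move=> s0 mf.
have sub : [set` `[s, (a * s)%R[] `<=` Rpos.
  by move=> x /=; rewrite in_itv/= => /andP[sx _]; apply/Rpos_gt0;
    exact: lt_le_trans sx.
apply: (cvge_to_le (@cvg_monotone_convergence _ _ _ mu _ _ (fun N x => (energy
  f N x)%:E) _ _ _)).
- exact: measurable_itv.
- by move=> N; apply: measurable_funS (energy_measurable N mf) => //;
  exact: measurable_Rpos.
- by move=> N x _; rewrite lee_fin energy_ge0.
- by move=> x _ M N MN; rewrite lee_fin le_energy.
- by apply: nearW => N; exact: integral_energy_le.
Qed.

Lemma dilation_cover x : 0 < x -> exists k : int, a ^ k <= x < a * a ^ k.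
Proof.
move=> x0; have la : 0 < ln a by rewrite ln_gt0.
exists (Num.floor (ln x / ln a)).
have E (l : int) : a ^ l = expR (l%:~R * ln a).
  by rewrite -powR_intmul ?(ltW a0)// /powR gt_eqF.
have xE : x = expR (ln x) by rewrite lnK ?posrE.
rewrite -{3}(expr1z a) -expfzDr ?gt_eqF// !E {2 3}xE ler_expR ltr_expR.
rewrite -ler_pdivlMr// -ltr_pdivrMr// addrC.
by rewrite floor_le /= floorD1_gt.
Qed.

(** On each dilate [a^k, a^(k+1)) of the fundamental domain the orbit energy has
    integral at most the squared norm of f, hence is finite almost everywhere;
    countably many such intervals cover the half line. *)
Lemma finite_energy_ae f : L2 f ->
  {ae mu, forall x, Rpos x -> (total_energy f x < +oo)%E}.
Proof.
move=> [mf ffin].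
have loc s : 0 < s -> {ae mu, forall x, [set` `[s, a * s[] x ->
  (total_energy f x < +oo)%E}.
  move=> s0.
  have sub : [set` `[s, (a * s)%R[] `<=` Rpos.
    by move=> x /=; rewrite in_itv/= => /andP[sx _]; apply/Rpos_gt0;
      exact: lt_le_trans sx.
  have : mu.-integrable [set` `[s, a * s[] (total_energy f).
    apply/integrableP; split.
      by apply: measurable_funS (total_energy_measurable mf) => //;
        exact: measurable_Rpos.
    under eq_integral do rewrite gee0_abs ?total_energy_ge0//.
    by apply: le_lt_trans ffin; exact: integral_total_energy_le.
  move=> ie.
  have : {ae mu, forall x, [set` `[s, a * s[] x ->
    total_energy f x \is a fin_num}.
    by apply: integrable_ae ie; exact: measurable_itv.
  apply: ae_imp => x /= H Dx; move: (H Dx).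
  by rewrite ge0_fin_numE ?total_energy_ge0.
have : {ae mu, forall x (k : int),
    [set` `[a ^ k, a * a ^ k[] x -> (total_energy f x < +oo)%E}.
  by apply: ae_forall_count => k; apply: loc; rewrite exprz_gt0.
apply: ae_imp => x /= H /Rpos_gt0 /dilation_cover[k kx].
by apply: (H k); rewrite in_itv.
Qed.

End dilation_coefficients.

(** * Limits almost everywhere *)

Section almost_everywhere_limits.
Context {R : realType} d (T : measurableType d).
Variables (mu : {measure set T -> \bar R}) (D : set T).
Hypothesis mD : measurable D.

(** Monotone convergence: the limit of the g n has finite integral, so it is
    finite almost everywhere. *)
Lemma monotone_ae_bounded (g : nat -> T -> R) (C : R) :
  (forall n, measurable_fun D (g n)) -> (forall n t, 0 <= g n t) ->
  (forall t, {homo g ^~ t : m n / (m <= n)%N >-> m <= n}) ->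
  (forall n, \int[mu]_(t in D) (g n t)%:E <= C%:E)%E ->
  {ae mu, forall t, D t -> exists M, forall n, g n t <= M}.
Proof.
move=> mg g0 ndg gC.
pose h t := limn (fun n => (g n t)%:E).
have hcvg t : (g n t)%:E @[n --> \oo] --> h t.
  by apply: ereal_nondecreasing_is_cvgn => m n mn; rewrite lee_fin ndg.
have gh n t : ((g n t)%:E <= h t)%E.
  by apply: (cvge_to_ge (hcvg t)); exists n => // m /= nm; rewrite lee_fin ndg.
have mh : measurable_fun D h.
  apply: (emeasurable_fun_cvg (fun n t => (g n t)%:E)) => //.
  by move=> n; exact/measurable_EFinP.
have : mu.-integrable D h.
  apply/integrableP; split => //.
  under eq_integral do rewrite gee0_abs ?(le_trans _ (gh 0%N _)) ?lee_fin//.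
  apply: (@le_lt_trans _ _ C%:E); last exact: ltry.
  apply: (cvge_to_le (@cvg_monotone_convergence _ _ _ mu _ _ (fun n t => (g n
    t)%:E) _ _ _)) => //.
  - by move=> n; exact/measurable_EFinP.
  - by move=> n t _; rewrite lee_fin.
  - by move=> t _ m n mn; rewrite lee_fin ndg.
  - by apply: nearW => n; exact: gC.
move=> /(integrable_ae mD); apply: ae_imp => t H /H hfin.
by exists (fine (h t)) => n; rewrite -lee_fin fineK.
Qed.

Lemma bounded_variation_cvg (u : R^nat) (M : R) :
  (forall n, \sum_(k < n) `|u k.+1 - u k| <= M) -> cvgn u.
Proof.
move=> uM.
have : cvgn [normed series (telescope u)].
  apply: nondecreasing_is_cvgn.
    by apply: nondecreasing_series => k _ _; exact: normr_ge0.
  exists M => _ [n _ <-].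
  rewrite (_ : [normed series (telescope u)] n
    = \sum_(k < n) `|u k.+1 - u k|)//.
  by rewrite /normed_series_of seriesEord.
move/normed_cvg; rewrite telescopeK => cu.
rewrite (_ : u = (fun n => (u n - u 0%N) + u 0%N)); last by apply/funext => n;
  rewrite subrK.
by apply: is_cvgD => //; exact: is_cvg_cst.
Qed.

(** The summable rate makes the series of increments converge absolutely
    almost everywhere: its L^1 norm is controlled by |v| <= h + |v|^2 / h with
    h = 2^-k, the square root of the bound on the k-th increment. *)
Lemma fast_cauchy_ae (u : (T -> R[i])^nat) : (mu D <= 1)%E ->
  (forall k, cmeasurable D (u k)) ->
  (forall k, sqn mu D (fun t => (u k.+1 t - u k t)%R)
    <= ((2^-1 ^+ k) ^+ 2)%:E)%E ->
  {ae mu, forall t, D t -> cvgn (fun k => complex.Re (u k t)) /\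
                           cvgn (fun k => complex.Im (u k t))}.
Proof.
move=> D1 mu_ uk.
pose v k t := cmod (u k.+1 t - u k t).
have v0 k t : 0 <= v k t by exact: cmod_ge0.
have mv2 k : measurable_fun D (fun t => v k t ^+ 2).
  by apply: measurable_cmod2; exact: cmeasurableB.
have mv k : measurable_fun D (v k).
  rewrite (_ : v k = fun t => Num.sqrt (v k t ^+ 2)); last first.
    by apply/funext => t; rewrite sqrtr_sqr ger0_norm.
  apply: measurableT_comp (mv2 k); apply: continuous_measurable_fun.
  exact: sqrt_continuous.
have h0 k : 0 < 2^-1 ^+ k :> R by rewrite exprn_gt0.
have vint k : (\int[mu]_(t in D) (v k t)%:E <= (2 * 2^-1 ^+ k)%:E)%E.
  set h := 2^-1 ^+ k; have {}h0 : 0 < h := h0 k.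
  apply: (@le_trans _ _ (\int[mu]_(t in D) (h%:E
    + h^-1%:E * (v k t ^+ 2)%:E))%E).
    apply: ge0_le_integral => //.
    - by move=> t _; rewrite lee_fin.
    - exact/measurable_EFinP.
    - by apply: emeasurable_funD => //; apply: measurable_funeM;
      exact/measurable_EFinP.
    move=> t _; rewrite -EFinM -EFinD lee_fin.
    have hh : h * h^-1 = 1 by rewrite mulfV ?gt_eqF.
    have hi : 0 < h^-1 by rewrite invr_gt0.
    have := mulr_ge0 (ltW hi) (sqr_ge0 (v k t - h)).
    have -> : h^-1 * (v k t - h) ^+ 2 =
      h^-1 * v k t ^+ 2 - 2 * (h * h^-1) * v k t + h * (h * h^-1) by ring.
    rewrite hh; have := v0 k t; lra.
  rewrite ge0_integralD//; last 3 first.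
  - by move=> t _; rewrite lee_fin ltW.
  - by move=> t _; apply: mule_ge0; rewrite lee_fin ?sqr_ge0 // invr_ge0 ltW.
  - by apply: measurable_funeM; exact/measurable_EFinP.
  rewrite integral_cst// ge0_integralZl_EFin//; last 3 first.
  - by move=> t _; rewrite lee_fin sqr_ge0.
  - exact/measurable_EFinP.
  - by rewrite invr_ge0 ltW.
  have -> : 2 * h = h + h^-1 * h ^+ 2 by field; rewrite gt_eqF.
  rewrite EFinD; apply: leeD.
    by rewrite -[leRHS]mule1; apply: lee_wpmul2l => //; rewrite lee_fin ltW.
  rewrite EFinM; apply: lee_wpmul2l; first by rewrite lee_fin invr_ge0 ltW.
  exact: uk.
pose g n t := \sum_(k < n) v k t.
have : {ae mu, forall t, D t -> exists M, forall n, g n t <= M}.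
  apply: (@monotone_ae_bounded g 4).
  - by move=> n; apply: measurable_sum => k.
  - by move=> n t; apply: sumr_ge0 => k _.
  - move=> t; apply: homo_leq => [//|x y z|n]; first exact: le_trans.
    by rewrite /g big_ord_recr/= lerDl.
  move=> n; rewrite /g; under eq_integral do rewrite -sumEFin.
  rewrite ge0_integral_sum//; last 2 first.
  - by move=> k; exact/measurable_EFinP.
  - by move=> k t _; rewrite lee_fin.
  apply: (@le_trans _ _ (\sum_(k < n) (2 * 2^-1 ^+ k)%:E)%E).
    by apply: lee_sum => k _; exact: vint.
  rewrite sumEFin lee_fin.
  have -> : \sum_(k < n) (2 * 2^-1 ^+ k) = 4 - 4 * 2^-1 ^+ n :> R.
    elim: n => [|n ih]; first by rewrite big_ord0 expr0; ring.
    by rewrite big_ord_recr/= ih exprS; field.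
  by have := h0 n; lra.
apply: ae_imp => t H /H[M gM].
split; apply: (@bounded_variation_cvg _ M) => n; apply: le_trans (gM n);
  apply: ler_sum => k _.
  by rewrite -cReN -cReD; exact: le_Re_cmod.
by rewrite -cImN -cImD; exact: le_Im_cmod.
Qed.

Lemma limn_einf_le (u v : (\bar R)^nat) (l : \bar R) :
  (forall k, (u k <= v k)%E) -> v @ \oo --> l -> (limn_einf u <= l)%E.
Proof.
move=> uv vl; rewrite limn_einf_lim -(cvg_lim _ vl)//.
apply: lee_lim; first exact: is_cvg_einfs.
  by apply/cvg_ex; exists l.
apply: nearW => n; apply: le_trans (uv n).
by apply: ereal_inf_lbound; exists n => /=.
Qed.

(** Fatou's lemma applied to the squared distances to g. *)
Lemma fatou_sqn (u : (T -> R[i])^nat) (f g : T ->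
  R[i]) (b : (\bar R)^nat) (l : \bar R) :
  (forall k, cmeasurable D (u k)) -> cmeasurable D f -> cmeasurable D g ->
  {ae mu, forall t, D t -> complex.Re (u k t) @[k --> \oo] --> complex.Re (f t)
    /\
                           complex.Im (u k t) @[k --> \oo] --> complex.Im (f
                             t)} ->
  (forall k, (sqn mu D (fun t => (u k t - g t)%R) <= b k)%E) -> b @ \oo --> l ->
  (sqn mu D (fun t => (f t - g t)%R) <= l)%E.
Proof.
move=> mu_ mf mg uf ub bl.
pose w k t := (cmod (u k t - g t) ^+ 2)%:E.
have mw k : measurable_fun D (w k) by apply: measurable_ecmod2;
  exact: cmeasurableB.
have w0 k t : (0 <= w k t)%E by rewrite lee_fin cmod2_ge0.
apply: (@le_trans _ _ (limn_einf (fun k => \int[mu]_(t in D) w k t)%E));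
  last first.
  exact: limn_einf_le ub bl.
apply: le_trans (fatou mu mD mw (fun k t _ => w0 k t)).
apply: ae_ge0_le_integral => //.
- by move=> t _; rewrite lee_fin cmod2_ge0.
- by apply: measurable_ecmod2; exact: cmeasurableB.
- move=> t _; rewrite limn_einf_lim; apply: lime_ge; first exact: is_cvg_einfs.
  by apply: nearW => n; apply: le_ereal_inf_tmp => _ [k _ <-].
- apply: (emeasurable_fun_cvg (fun n t => einfs (w ^~ t) n)).
    exact: measurable_fun_einfs.
  by move=> t _; rewrite limn_einf_lim; exact: is_cvg_einfs.
apply: ae_imp uf => t H /H[Reu Imu].
rewrite (cvg_limn_einf_sup (l := (cmod (f t - g t) ^+ 2)%:E))//.
apply/cvg_EFin; first exact: nearW.
rewrite cmod2E cReD cImD cReN cImN (_ : fine \o _ = fun k =>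
  (complex.Re (u k t) - complex.Re (g t)) ^+ 2 +
  (complex.Im (u k t) - complex.Im (g t)) ^+ 2); last first.
  by apply/funext => k; rewrite /= cmod2E cReD cImD cReN cImN.
by apply: cvgD; apply: cvgM; apply: cvgB => //; exact: cvg_cst.
Qed.

End almost_everywhere_limits.

(** * Existence of the transform *)

Section theta_transform.
Context {R : realType}.
Local Notation mu := (@lebesgue_measure R).
Variable a : R.
Hypothesis a1 : 1 < a.
Implicit Types (f : R -> R[i]) (x xi : R) (l : int) (M N k : nat).

Definition period_itv : set R := [set` `[0%R, 1%R[].

Lemma measurable_period_itv : measurable period_itv.
Proof. exact: measurable_itv. Qed.

Lemma period_itv_le1 : (mu period_itv <= 1)%E.
Proof. by rewrite /period_itv lebesgue_measure_itv/= lte_fin ltr01 oppr0 adde0.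
  Qed.

Lemma big_irange_sub (V : nmodType) (F : int -> V) M N : (M <= N)%N ->
  \sum_(l <- irange M) F l = \sum_(l <- irange N) (if l \in irange M then F l
    else 0).
Proof.
move=> MN; rewrite -big_mkcond -big_filter; apply: perm_big; apply: uniq_perm.
- exact: irange_uniq.
- by rewrite filter_uniq// irange_uniq.
move=> l; rewrite mem_filter !mem_irange; apply/idP/andP => [lM|[]//].
by split => //; apply: le_trans lM _.
Qed.

Lemma theta_psum_measurable f N : cmeasurable Rpos f ->
  cmeasurable (Rpos `*` [set: R]) (fun p => theta_psum a f N p.1 p.2).
Proof.
move=> mf; under eq_fun do rewrite theta_psumE.
apply: cmeasurable_sum => l; apply: cmeasurableM.
  apply: (cmeasurable_comp (h := coef a f l) (E := Rpos) (u := fst)).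
  - exact: measurable_Rpos.
  - by move=> p [].
  - exact: measurable_funTS measurable_fst.
  - exact: coef_measurable.
by apply: fmode_measurable; exact: measurable_funTS measurable_snd.
Qed.

Lemma theta_psum_measurable2 f N x (D : set R) : cmeasurable D (theta_psum a f
  N x).
Proof.
rewrite (_ : theta_psum a f N x
  = fun xi => \sum_(l <- irange N) coef a f l x * fmode l xi).
  apply: cmeasurable_sum => l; apply: cmeasurableM;
    first exact: cmeasurable_cst.
  exact: fmode_measurable.
by apply/funext => xi; rewrite theta_psumE.
Qed.

Lemma slice_measurable (F : R * R -> R[i]) x (D : set R) : Rpos x ->
  cmeasurable (Rpos `*` [set: R]) F -> cmeasurable D (fun xi => F (x, xi)).
Proof.
move=> x0 mF; apply: (cmeasurable_comp (u := pair x) _ _ _ mF) => //.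
  by apply: measurableX => //; exact: measurable_Rpos.
by apply: measurable_funTS; exact: pair1_measurable.
Qed.

Lemma theta_psum_period f N x xi : theta_psum a f N x (xi + 1)
  = theta_psum a f N x xi.
Proof. by rewrite !theta_psumE; under eq_bigr do rewrite fmode_period. Qed.

Lemma sqn_theta_psum f N x :
  sqn mu period_itv (theta_psum a f N x) = (energy a f N x)%:E.
Proof.
rewrite -fourier_parseval ?irange_uniq//; apply: eq_integral => xi _.
by rewrite theta_psumE.
Qed.

Lemma theta_psum_dist f x M N : (M <= N)%N ->
  sqn mu period_itv (fun xi => theta_psum a f N x xi - theta_psum a f M x xi) =
  (energy a f N x - energy a f M x)%:E.
Proof.
move=> MN.
pose h l := if l \in irange M then 0 else coef a f l x.
transitivity (\int[mu]_(xi in period_itv)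
    (cmod (\sum_(l <- irange N) h l * fmode l xi) ^+ 2)%:E)%E.
  apply: eq_integral => xi _; congr (cmod _ ^+ 2)%:E.
  rewrite !theta_psumE (big_irange_sub _ MN) -sumrB; apply: eq_bigr => l _.
  by rewrite /h; case: ifPn => _; rewrite ?subrr ?mul0r ?subr0.
rewrite fourier_parseval ?irange_uniq//; congr EFin.
rewrite /energy (big_irange_sub _ MN) -sumrB; apply: eq_bigr => l _.
by rewrite /h; case: ifPn => _; rewrite ?subrr ?subr0// cmod0 expr0n.
Qed.

Lemma theta_psum_dist_abs f x M N :
  sqn mu period_itv (fun xi => theta_psum a f N x xi - theta_psum a f M x xi) =
  `|energy a f N x - energy a f M x|%:E.
Proof.
have [MN|/ltnW NM] := leqP M N.
  by rewrite theta_psum_dist// ger0_norm// subr_ge0 le_energy.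
by rewrite sqnB theta_psum_dist// distrC ger0_norm// subr_ge0 le_energy.
Qed.

(** At level k the transform is approximated by the first partial sum whose
    missing energy is at most 4^-k.  The rank depends on x but is a measurable
    function of x alone, so the approximants are jointly measurable and still
    converge fast enough for pointwise convergence in xi. *)
Definition good_rank f k x N : bool :=
  (total_energy a f x <= (energy a f N x + (2^-1 ^+ k) ^+ 2)%:E)%E.

Definition rank f k x : nat :=
  if pselect (exists N, good_rank f k x N) is left h then ex_minn h else 0%N.

Lemma good_rank_mono f k x M N : (M <= N)%N -> good_rank f k x M ->
  good_rank f k x N.
Proof.
move=> MN /le_trans; apply; rewrite lee_fin lerD2r; exact: le_energy.
Qed.

Lemma rank_good f k x : (total_energy a f x < +oo)%E ->
  good_rank f k x (rank f k x).
Proof.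
move=> fin; rewrite /rank; case: pselect => [h|]; first by case: ex_minnP.
case.
have ffin : total_energy a f x \is a fin_num
  by rewrite ge0_fin_numE ?total_energy_ge0.
have e0 : 0 < (2^-1 ^+ k) ^+ 2 :> R by rewrite !exprn_gt0.
have := energy_cvg (a := a) (f := f) (x := x).
rewrite -(fineK ffin) => /fine_cvgP[_] /cvgrPdist_le /(_ _ e0)[N _ /(_ N (leqnn
  N))] /= H.
exists N; rewrite /good_rank -(fineK ffin) lee_fin -lerBlDl.
by rewrite (le_trans _ H)// ler_norm.
Qed.

(** The energy increases with the number of terms, so the least good rank is
    located by two consecutive ranks; this is what makes its level sets
    measurable. *)
Lemma rankP f k x N : rank f k x
  = N.+1 <-> (good_rank f k x N.+1 /\ ~~ good_rank f k x N).
Proof.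
rewrite /rank; case: pselect => [h|nh]; last first.
  by split => // -[g _]; exfalso; apply: nh; exists N.+1.
case: ex_minnP => m gm mmin; split => [mN|[gN ngN]].
  rewrite -mN; split => //; apply/negP => /mmin; rewrite mN ltnn//.
apply/eqP; rewrite eqn_leq mmin//= ltnNge; apply/negP => mN.
by move/negP: ngN; apply; exact: good_rank_mono gm.
Qed.

Lemma rank_measurable f k N : cmeasurable Rpos f ->
  measurable (Rpos `&` [set x | rank f k x = N]).
Proof.
move=> mf.
have mg M : measurable (Rpos `&` [set x | good_rank f k x M]).
  rewrite (_ : [set x | _] = [set x | (total_energy a f x <=
      (energy a f M x)%:E + ((2^-1 ^+ k) ^+ 2)%:E)%E]); last first.
    by apply/seteqP; split => x; rewrite /good_rank/= EFinD.
  apply: measurable_lee => //; first exact: measurable_Rpos.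
    exact: total_energy_measurable.
  by apply: emeasurable_funD => //; exact: energy_measurable.
have mS M : measurable (Rpos `&` [set x | rank f k x = M.+1]).
  rewrite (_ : _ `&` _ = (Rpos `&` [set x | good_rank f k x M.+1]) `\`
     (Rpos `&` [set x | good_rank f k x M])); first exact: measurableD.
  apply/seteqP; split => x /=.
    by move=> [x0 /rankP[g1 g2]]; split => // -[_ g3]; rewrite g3 in g2.
  move=> [[x0 g1] g2]; split => //; apply/rankP; split => //.
  by apply/negP => g3; exact: g2.
case: N => [|N]; last exact: mS.
rewrite (_ : _ `&` _ = Rpos `\` \bigcup_M (Rpos `&` [set x | rank f k x
  = M.+1])).
  by apply: measurableD; [exact: measurable_Rpos|exact: bigcupT_measurable].
apply/seteqP; split => x /=.
  by move=> [x0 r0]; split => // -[M _ [_ /=]]; rewrite r0.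
move=> [x0 nr]; split => //; case E : (rank f k x) => [//|M].
by exfalso; apply: nr; exists M.
Qed.

Definition theta_approx f k (p : R * R) : R[i] :=
  theta_psum a f (rank f k p.1) p.1 p.2.

Lemma theta_approx_measurable f k : cmeasurable Rpos f ->
  cmeasurable (Rpos `*` [set: R]) (theta_approx f k).
Proof.
move=> mf.
pose A N := (Rpos `&` [set x | rank f k x = N]) `*` [set: R].
have mA N : measurable (A N) by apply: measurableX => //;
  exact: rank_measurable.
have -> : Rpos `*` [set: R] = \bigcup_N A N.
  apply/seteqP; split => [[x xi] [/= x0 _]|[x xi] [N _ [[]]]//].
  by exists (rank f k x).
have H N : cmeasurable (A N) (theta_approx f k).
  apply: (@eq_cmeasurable _ _ _ _ (fun p => theta_psum a f N p.1 p.2)).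
    by move=> [x xi] [[_ /= <-] _].
  apply: cmeasurableS (theta_psum_measurable N mf).
    by apply: measurableX => //; exact: measurable_Rpos.
  by move=> p [[]].
by split; apply/(measurable_fun_bigcup _ mA) => N; case: (H N).
Qed.

(** The upper limit is defined and measurable everywhere, and agrees with the
    limit wherever the approximants converge. *)
Definition theta_rep f (p : R * R) : R[i] :=
  fine (limn_esup (fun k => (complex.Re (theta_approx f k p))%:E)) +i*
  fine (limn_esup (fun k => (complex.Im (theta_approx f k p))%:E)).

Lemma theta_rep_measurable f : cmeasurable Rpos f ->
  cmeasurable (Rpos `*` [set: R]) (theta_rep f).
Proof.
move=> mf; have H k := theta_approx_measurable k mf.
split; (apply: measurableT_comp; first exact: fine_measurable);
  apply: measurable_fun_limn_esup => k; apply/measurable_EFinP; by case: (H k).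
Qed.

Lemma theta_rep_cvg f x : cmeasurable Rpos f -> Rpos x ->
  (total_energy a f x < +oo)%E ->
  {ae mu, forall xi, period_itv xi ->
    complex.Re (theta_approx f k (x,
      xi)) @[k --> \oo] --> complex.Re (theta_rep f (x, xi)) /\
    complex.Im (theta_approx f k (x,
      xi)) @[k --> \oo] --> complex.Im (theta_rep f (x, xi))}.
Proof.
move=> mf x0 fin.
have ffin : total_energy a f x \is a fin_num
  by rewrite ge0_fin_numE ?total_energy_ge0.
have Ele N : energy a f N x <= fine (total_energy a f x).
  by rewrite -lee_fin fineK// energy_le_total.
have Ege k : fine (total_energy a f x)
  <= energy a f (rank f k x) x + (2^-1 ^+ k) ^+ 2.
  by rewrite -lee_fin fineK//; exact: rank_good.
have : {ae mu, forall xi, period_itv xi ->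
    cvgn (fun k => complex.Re (theta_approx f k (x, xi))) /\
    cvgn (fun k => complex.Im (theta_approx f k (x, xi)))}.
  apply: (@fast_cauchy_ae R _ (measurableTypeR R) mu period_itv _ (fun k xi =>
    theta_approx f k (x, xi))).
  - exact: measurable_period_itv.
  - exact: period_itv_le1.
  - move=> k; exact (theta_psum_measurable2 f (rank f k x) x period_itv).
  move=> k; rewrite /theta_approx/= theta_psum_dist_abs lee_fin ler_norml.
  have q0 : 0 <= (2^-1 ^+ k) ^+ 2 :> R by rewrite sqr_ge0.
  have q1 : (2^-1 ^+ k.+1) ^+ 2 <= (2^-1 ^+ k) ^+ 2 :> R.
    by rewrite [2^-1 ^+ k.+1]exprS exprMn; move: q0; lra.
  by have := Ege k; have := Ege k.+1; have := Ele (rank f k x);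
    have := Ele (rank f k.+1 x); lra.
apply: ae_imp => xi H /H[cRe cIm].
have key (u : R^nat) : cvgn u -> u @ \oo --> fine (limn_esup (EFin \o u)).
  move=> cu; have /cvg_limn_einf_sup[_ ->] : EFin \o u @ \oo --> (limn u)%:E.
    by apply: cvg_EFin; [exact: nearW|exact: cu].
  exact: cu.
by split; exact: key.
Qed.

(** On the fibre over x the squared distance from the limit of the approximants
    to the N-th partial sum is at most the energy missing after N terms. *)
Lemma theta_rep_is_theta f : L2 f -> is_theta a f (theta_rep f).
Proof.
move=> fL2; have [mf _] := fL2; split.
- exact: theta_rep_measurable.
- move=> x xi; rewrite /theta_rep/theta_approx/=.
  by under eq_fun do rewrite theta_psum_period;
     under [in X in _ +i* X]eq_fun do rewrite theta_psum_period.
have := finite_energy_ae a1 fL2; apply: ae_imp => x H x0; have {H}fin := H x0.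
have ffin : total_energy a f x \is a fin_num
  by rewrite ge0_fin_numE ?total_energy_ge0.
have Ele N : energy a f N x <= fine (total_energy a f x).
  by rewrite -lee_fin fineK// energy_le_total.
have Ege k : fine (total_energy a f x)
  <= energy a f (rank f k x) x + (2^-1 ^+ k) ^+ 2.
  by rewrite -lee_fin fineK//; exact: rank_good.
apply: (@squeeze_cvge0 _ _ (fun N => (fine (total_energy a f x) - energy a f N
  x)%:E)).
- by move=> N; exact: sqn_ge0.
- move=> N; apply: (@fatou_sqn R _ (measurableTypeR R) mu period_itv
  measurable_period_itv
    (fun k xi => theta_approx f k (x, xi)) (fun xi => theta_rep f (x, xi))
    (theta_psum a f N x)
    (fun k => (fine (total_energy a f x) - energy a f N x
      + (2^-1 ^+ k) ^+ 2)%:E)).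
  + move=> k; exact (theta_psum_measurable2 f (rank f k x) x period_itv).
  + exact (@slice_measurable _ x period_itv x0 (theta_rep_measurable mf)).
  + exact (theta_psum_measurable2 f N x period_itv).
  + exact: theta_rep_cvg.
  + move=> k; rewrite /theta_approx/= theta_psum_dist_abs lee_fin ler_norml.
    have q0 : 0 <= (2^-1 ^+ k) ^+ 2 :> R by rewrite sqr_ge0.
    by have := Ege k; have := Ele (rank f k x); have := Ele N; lra.
  + apply: cvg_EFin; first exact: nearW.
    rewrite -[X in _ --> X]addr0; apply: cvgD; first exact: cvg_cst.
    rewrite -[X in _ --> X](mulr0 0); apply: cvgM; rewrite exprn_geometric;
      apply: cvg_geometric; rewrite ger0_norm// invf_lt1//; lra.
apply: cvg_EFin; first exact: nearW.
have := energy_cvg (a := a) (f := f) (x := x);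
  rewrite -(fineK ffin) => /fine_cvgP[_] H.
rewrite -[X in _ --> X](subrr (fine (total_energy a f x))).
by apply: cvgB => //; exact: cvg_cst.
Qed.

Lemma Theta_is_theta f : L2 f -> is_theta a f (Theta a f).
Proof.
by move=> fL2; apply: (@xgetPex _ (fun=> 0) [set F | is_theta a f F]);
  exists (theta_rep f); exact: theta_rep_is_theta.
Qed.

End theta_transform.

(** * Mean-square convergence on the fundamental cell *)

Section theta_square_integrable.
Context {R : realType}.
Local Notation mu := (@lebesgue_measure R).
Local Notation mu2 := (@lebesgue_measure R \x @lebesgue_measure R)%E.
Variable a : R.
Hypothesis a1 : 1 < a.
Implicit Types (f : R -> R[i]) (x xi : R) (l : int) (M N k : nat).

Definition base_itv : set R := [set` `[1, a[].
Definition theta_cell : set (R * R) := base_itv `*` period_itv.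

Lemma base_itvE : base_itv = [set` `[1, a * 1[].
Proof. by rewrite mulr1. Qed.

Lemma measurable_base_itv : measurable base_itv.
Proof. exact: measurable_itv. Qed.

Lemma base_itv_pos : base_itv `<=` Rpos.
Proof.
move=> x; rewrite /base_itv/= in_itv/= => /andP[x1 _]; apply/Rpos_gt0.
exact: lt_le_trans x1.
Qed.

Lemma measurable_theta_cell : measurable theta_cell.
Proof. by apply: measurableX;
  [exact: measurable_base_itv|exact: measurable_period_itv]. Qed.

Lemma theta_cell_sub : theta_cell `<=` Rpos `*` [set: R].
Proof. by move=> [x xi] [/= /base_itv_pos]. Qed.

Lemma theta_cell_measurable (F : R * R -> R[i]) :
  cmeasurable (Rpos `*` [set: R]) F -> cmeasurable theta_cell F.
Proof.
apply: cmeasurableS; last exact: theta_cell_sub.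
by apply: measurableX => //; exact: measurable_Rpos.
Qed.

Lemma sqn_theta_cell (F : R * R -> R[i]) : cmeasurable theta_cell F ->
  sqn mu2 theta_cell F =
  (\int[mu]_(x in base_itv) sqn mu period_itv (fun xi => F (x, xi)))%E.
Proof.
move=> mF; rewrite /sqn (@tonelli_rect R _ _ (measurableTypeR R)
  (measurableTypeR R))//.
- exact: measurable_base_itv.
- exact: measurable_period_itv.
- exact (measurable_ecmod2 mF).
- by move=> p _; rewrite lee_fin cmod2_ge0.
Qed.

Lemma sqn_slice_measurable (F : R * R -> R[i]) : cmeasurable theta_cell F ->
  measurable_fun base_itv (fun x => sqn mu period_itv (fun xi => F (x, xi))).
Proof.
move=> mF; rewrite /sqn.
apply: (@measurable_inner_integral R _ _ (measurableTypeR R) (measurableTypeR R)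
  mu base_itv period_itv _ _ (fun p => (cmod (F p) ^+ 2)%:E)).
- exact: measurable_base_itv.
- exact: measurable_period_itv.
- exact (measurable_ecmod2 mF).
- by move=> p _; rewrite lee_fin cmod2_ge0.
Qed.

(** The distance between the transform and its N-th partial sum on the fibre
    over x is dominated by twice the energy of the orbit of x, which is
    integrable over the fundamental domain; so fibrewise convergence implies
    convergence on the whole cell. *)
Lemma theta_psum_cvgL2 f F : L2 f -> is_theta a f F ->
  cvgL2 mu2 theta_cell (fun N p => theta_psum a f N p.1 p.2) F.
Proof.
move=> fL2 [mF _ Fcvg]; have [mf ffin] := fL2.
have mS N := theta_cell_measurable (theta_psum_measurable (a := a) a1 N mf).
have mFc := theta_cell_measurable mF.
split.
- move=> N; exact (mS N).
- exact mFc.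
pose dist N x := sqn mu period_itv (fun xi => theta_psum a f N x xi - F (x,
  xi)).
have mD N := cmeasurableB (mS N) mFc.
rewrite (_ : (fun n => _) = (fun N => \int[mu]_(x in base_itv) dist N x)%E);
  last first.
  by apply/funext => N; rewrite (sqn_theta_cell (mD N)).
have good : {ae mu, forall x, Rpos x -> (total_energy a f x < +oo)%E /\
    (dist N x @[N --> \oo] --> 0%E)}.
  have := finite_energy_ae a1 fL2; move: Fcvg; apply: ae_imp2 => x H1 H2 x0.
  split; first exact: H2.
  rewrite (_ : (fun N => dist N x) = fun N =>
    sqn mu period_itv (fun xi => F (x, xi) - theta_psum a f N x xi)).
    exact: H1.
  by apply/funext => N; exact: sqnB.
have distle N x : Rpos x -> (total_energy a f x < +oo)%E ->
    dist N x @[N --> \oo] --> 0%E -> (dist N x <= 2%:E * total_energy a f x)%E.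
  move=> x0 fin dcvg.
  have ffin' : total_energy a f x \is a fin_num
    by rewrite ge0_fin_numE ?total_energy_ge0.
  have Ele M : energy a f M x <= fine (total_energy a f x).
    by rewrite -lee_fin fineK// energy_le_total.
  pose b M := (2%:E * total_energy a f x + 2%:E * dist M x)%E.
  have bl : b @ \oo --> (2%:E * total_energy a f x)%E.
    rewrite -[X in _ --> X]adde0; apply: cvgeD.
    - by rewrite fin_num_adde_defr// fin_numM.
    - exact: cvg_cst.
    - by rewrite -(mule0 2%:E); exact: cvgeZl.
  apply: (cvge_to_ge bl); apply: nearW => M; rewrite /b.
  rewrite /dist (_ : sqn _ _ _ = sqn mu period_itv (fun xi =>
     (theta_psum a f N x xi - theta_psum a f M x xi) +
     (theta_psum a f M x xi - F (x, xi)))); last first.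
    by apply: eq_sqn => xi _; ring.
  have m1 : cmeasurable period_itv (fun xi => theta_psum a f N x xi -
    theta_psum a f M x xi).
    by apply: cmeasurableB; exact: theta_psum_measurable2.
  have m2 : cmeasurable period_itv (fun xi => theta_psum a f M x xi - F (x,
    xi)).
    by apply: cmeasurableB; [exact: theta_psum_measurable2|exact:
      slice_measurable].
  apply: le_trans; first exact (@sqnD_le R _ (measurableTypeR R) mu period_itv
    measurable_period_itv _ _ m1 m2).
  apply: leeD => //; apply: lee_wpmul2l; first by rewrite lee_fin.
  rewrite theta_psum_dist_abs// -(fineK ffin') lee_fin ler_norml.
  by have := Ele M; have := Ele N; have := energy_ge0 a f M x;
    have := energy_ge0 a f N x; lra.
have pointwise : {ae mu, forall x, base_itv x -> dist ^~ x @ \oo --> cst 0%E x}.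
  by move: good; apply: ae_imp => x H /base_itv_pos/H[].
have dominating : mu.-integrable base_itv (fun x => 2%:E * total_energy a f
  x)%E.
  apply: integrableZl; first exact: measurable_base_itv.
  apply/integrableP; split.
    apply: measurable_funS (total_energy_measurable a1 mf);
      first exact: measurable_Rpos.
    exact: base_itv_pos.
  under eq_integral do rewrite gee0_abs ?total_energy_ge0//.
  rewrite base_itvE; apply: le_lt_trans ffin.
  exact: integral_total_energy_le.
have dominated : {ae mu, forall x N, base_itv x ->
    (`|dist N x| <= 2%:E * total_energy a f x)%E}.
  move: good; apply: ae_imp => x H N /base_itv_pos x0; have [h1 h2] := H x0.
  rewrite gee0_abs; last exact: sqn_ge0.
  exact: distle.
have [_ _] := @dominated_convergence _ (measurableTypeR R) R mu base_itv
  measurable_base_itv dist (cst 0%E) (fun x => 2%:E * total_energy a f x)%E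
  (fun N => sqn_slice_measurable (mD N)) (measurable_cst _)
  pointwise dominating dominated.
by rewrite integral0; apply.
Qed.

End theta_square_integrable.

(** * Modulated dilates *)

Section atoms.
Context {R : realType}.
Local Notation mu := (@lebesgue_measure R).
Variable a : R.
Hypothesis a1 : 1 < a.
Implicit Types (f : R -> R[i]) (x xi : R) (m j l : int) (M N k : nat).

Let a0 : 0 < a. Proof. exact: lt_trans a1. Qed.

Definition atom m j f : R ->
  R[i] := fun x => Lambda a m x * dilation (a ^ j) f x.

Lemma cmod_Lambda m x : cmod (Lambda a m x) ^+ 2 = (a - 1)^-1.
Proof.
rewrite /Lambda cmodM exprMn cmod_real cmod_cexp mulr1 exprVn sqr_sqrtr//.
by rewrite subr_ge0 ltW.
Qed.

Lemma Lambda_dilate m l x : 0 < x -> Lambda a m (a ^ l * x) = Lambda a m x.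
Proof.
have up k y : 0 < y -> Lambda a m (a ^ k%:Z * y) = Lambda a m y.
  elim: k y => [|k ih] y y0; first by rewrite expr0z mul1r.
  rewrite (_ : a ^ k.+1%:Z * y = a * (a ^ k%:Z * y)).
    by rewrite Lambda_periodic ?ih// dilate_pos.
  by rewrite -!exprnP exprS mulrA.
move=> x0; case: l => k; first exact: up.
rewrite NegzE -[in RHS](mul1r x) -(mulfV (x := a ^ k.+1%:Z)); last first.
  by rewrite gt_eqF// exprz_gt0.
rewrite -mulrA -invr_expz up//; apply: mulr_gt0 => //.
by rewrite invr_gt0 exprz_gt0.
Qed.

Lemma fold_dil_measurable : measurable_fun setT (fold_dil a : R -> R).
Proof.
rewrite (_ : fold_dil a = fun x => x * a `^ (- (Num.floor (ln x / ln a))%:~R));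
  last first.
  by apply/funext => x; rewrite /fold_dil -mulrNz powR_intmul// ltW.
have mfl : measurable_fun setT (fun y : R => (Num.floor y)%:~R : R).
  apply: nondecreasing_measurable => //.
  by move=> y z yz; rewrite ler_int le_floor.
have mln : measurable_fun setT (fun y : R => ln y / ln a).
  by apply: measurable_funM => //; exact: measurable_ln.
apply: measurable_funM => //.
apply: (measurableT_comp (measurable_powRr a)); apply: measurableT_comp => //.
exact: (measurableT_comp mfl mln).
Qed.

Lemma Lambda_measurable m : cmeasurable setT (Lambda a m).
Proof.
apply: cmeasurableM; first exact: cmeasurable_cst.
apply: cmeasurable_cexp; apply: measurable_funM => //;
  apply: measurable_funM => //.
exact: fold_dil_measurable.
Qed.

Lemma dilation_measurable j f : cmeasurable Rpos f ->
  cmeasurable Rpos (dilation (a ^ j) f).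
Proof.
move=> mf; apply: cmeasurableM; first exact: cmeasurable_cst.
apply: (cmeasurable_comp (E := Rpos) (u := fun x => a ^ j * x)) => //.
- exact: measurable_Rpos.
- by move=> x /Rpos_gt0 x0; apply/Rpos_gt0; exact: dilate_pos.
- exact: measurable_funM.
Qed.

Lemma sqn_dilation j f : cmeasurable Rpos f ->
  sqn mu Rpos (dilation (a ^ j) f) = sqn mu Rpos f.
Proof.
move=> mf; have c0 : 0 < a ^ j by rewrite exprz_gt0.
rewrite /sqn [RHS](@ge0_integral_dilate _ (a ^ j))//; last 3 first.
- exact: measurable_Rpos.
- exact: measurable_ecmod2.
- by move=> x _; rewrite lee_fin cmod2_ge0.
have -> : (fun x => a ^ j * x) @^-1` Rpos = Rpos.
  apply/seteqP; split => x /=; rewrite !Rpos_gt0; last exact: dilate_pos.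
  by rewrite pmulr_rgt0.
rewrite -ge0_integralZl_EFin//; last 4 first.
- exact: measurable_Rpos.
- by move=> x _; rewrite lee_fin cmod2_ge0.
- apply: measurable_ecmod2.
  apply: (cmeasurable_comp (E := Rpos) (u := fun x => a ^ j * x)) mf => //.
    exact: measurable_Rpos.
  by move=> x /Rpos_gt0 x0; apply/Rpos_gt0; exact: dilate_pos.
- exact: measurable_funM.
- exact: ltW.
apply: eq_integral => x _;
  rewrite /dilation cmodM exprMn cmod_real sqr_sqrtr ?EFinM//.
exact: ltW.
Qed.

Lemma atom_measurable m j f : cmeasurable Rpos f ->
  cmeasurable Rpos (atom m j f).
Proof.
move=> mf; apply: cmeasurableM; last exact: dilation_measurable.
by apply: cmeasurableS (Lambda_measurable m).
Qed.

Lemma atom_cvgL2 m j u f :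
  cvgL2 mu Rpos u f -> cvgL2 mu Rpos (fun n => atom m j (u n)) (atom m j f).
Proof.
move=> [mu_ mf uf]; apply: (@cvgL2M R _ (measurableTypeR R) mu Rpos _ (a -
  1)^-1).
- exact: measurable_Rpos.
- exact (cmeasurableS measurableT (@subsetT _ _) (Lambda_measurable m)).
- by move=> x _; rewrite cmod_Lambda.
split.
- move=> n; exact (dilation_measurable j (mu_ n)).
- exact (dilation_measurable j mf).
rewrite (_ : (fun n => _) = fun n => sqn mu Rpos (fun t => u n t - f t))//.
apply/funext => n.
rewrite -[RHS](@sqn_dilation j); last exact (cmeasurableB (mu_ n) mf).
by apply: eq_sqn => x _; rewrite /dilation mulrBr.
Qed.

Lemma sqn_atom_lty m j f : L2 f -> (sqn mu Rpos (atom m j f) < +oo)%E.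
Proof.
move=> [mf ffin].
apply: (@le_lt_trans _ _ ((a - 1)^-1%:E * sqn mu Rpos (dilation (a ^ j) f))%E).
  apply: (@le_sqn R _ (measurableTypeR R) mu Rpos measurable_Rpos).
  - by rewrite invr_ge0 subr_ge0 ltW.
  - exact (atom_measurable m j mf).
  - exact (dilation_measurable j mf).
  - by move=> x _; rewrite /atom cmodM exprMn cmod_Lambda.
by rewrite sqn_dilation// lte_mul_pinfty ?lee_fin ?invr_ge0 ?subr_ge0 ?ltW.
Qed.

(** A modulation is dilation periodic, hence constant along an orbit, and a
    dilation shifts the orbit: modulated dilates become multiplications by
    exponentials on the transform side. *)
Lemma coef_atom m j f l x : 0 < x ->
  coef a (atom m j f) l x = Lambda a m x * coef a f (l + j) x.
Proof.
move=> x0; rewrite /coef /atom /dilation Lambda_dilate// mulrCA; congr (_ * _).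
rewrite mulrA; congr (_ * f _); last first.
  by rewrite mulrA -expfzDr ?gt_eqF// addrC.
rewrite -rmorphM/=; congr (_%:C).
rewrite -powR12_sqrt ?ltW ?exprz_gt0// -powR_intmul ?ltW// -powRrM.
rewrite -powRD; last by rewrite (gt_eqF a0) implybT.
by rewrite intrD; congr (_ `^ _); field.
Qed.

Lemma coef_lincomb I (r : seq I) (c : I -> R[i]) (f : I -> R -> R[i]) l x :
  coef a (fun y => \sum_(i <- r) c i * f i y) l x
    = \sum_(i <- r) c i * coef a (f i) l x.
Proof.
by rewrite /coef mulr_sumr; apply: eq_bigr => i _; rewrite mulrCA.
Qed.

(** A truncated function meets each orbit in finitely many points, so that its
    transform over the fundamental domain is a trigonometric polynomial, namely
    the N-th partial sum of the transform of f. *)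
Definition trunc N f : R -> R[i] :=
  fun x => if x \in `[a ^ (- N%:Z), a ^ N.+1%:Z[ then f x else 0.

Lemma trunc_measurable N f : cmeasurable Rpos f -> cmeasurable Rpos (trunc N f).
Proof.
move=> mf.
have mb : measurable_fun Rpos (fun x : R => x \in `[a ^ (- N%:Z), a ^ N.+1%:Z[).
  apply: (measurable_fun_bool true).
  rewrite (_ : _ @^-1` _ = [set` `[a ^ (- N%:Z), a ^ N.+1%:Z[])//.
  by apply: measurableI; [exact: measurable_Rpos|exact: measurable_itv].
have H (p : R[i] -> R) : p 0 = 0 -> measurable_fun Rpos (fun x => p (f x)) ->
    measurable_fun Rpos (fun x => p (trunc N f x)).
  move=> p0 mp; rewrite (_ : (fun x => _) = fun x =>
      if x \in `[a ^ (- N%:Z), a ^ N.+1%:Z[ then p (f x) else 0).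
    apply: measurable_fun_if => //; first exact: measurable_Rpos.
    apply: measurable_funS mp; first exact: measurable_Rpos.
    by move=> x [].
  by apply/funext => x; rewrite /trunc; case: ifP.
by case: mf => m1 m2; split; exact: H.
Qed.

Lemma trunc_eventually f x : 0 < x -> \forall N \near \oo, trunc N f x = f x.
Proof.
move=> /(dilation_cover a1)[k /andP[kx xk]]; exists (absz k) => // N /= kN.
have kN' : (`|k| <= N%:Z)%R by rewrite -abszE.
move: kN'; rewrite ler_norml => /andP[k1 k2].
rewrite /trunc in_itv/= (le_trans _ kx); last by rewrite ler_weXz2l ?(ltW a1).
rewrite (lt_le_trans xk)//.
rewrite -{1}(expr1z a) -expfzDr ?gt_eqF// ler_weXz2l ?(ltW a1)//; lia.
Qed.

Lemma trunc_cvgL2 f : L2 f -> cvgL2 mu Rpos (fun N => trunc N f) f.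
Proof.
move=> [mf ffin]; split.
- move=> N; exact (trunc_measurable N mf).
- exact mf.
pose h N x := (cmod (trunc N f x - f x) ^+ 2)%:E.
have mh N : measurable_fun Rpos (h N).
  by apply: measurable_ecmod2; apply: cmeasurableB => //;
    exact: trunc_measurable.
have pointwise : {ae mu, forall x, Rpos x -> h ^~ x @ \oo --> cst 0%E x}.
  apply: aeW => x /Rpos_gt0/(trunc_eventually f) ev.
  apply: cvg_near_cst; move: ev; apply: filterS => N E.
  by rewrite /h E subrr cmod0 expr0n.
have dominating : mu.-integrable Rpos (fun x => (cmod (f x) ^+ 2)%:E).
  apply/integrableP; split; first exact (measurable_ecmod2 mf).
  by under eq_integral do rewrite gee0_abs ?lee_fin ?cmod2_ge0//.
have dominated : {ae mu, forall x N, Rpos x ->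
  (`|h N x| <= (cmod (f x) ^+ 2)%:E)%E}.
  apply: aeW => x N _; rewrite gee0_abs ?lee_fin ?cmod2_ge0// /trunc.
  by case: ifP => _; rewrite ?subrr ?sub0r ?cmodN// cmod0 expr0n cmod2_ge0.
have [_ _] := @dominated_convergence _ (measurableTypeR R) R mu Rpos
  measurable_Rpos h (cst 0%E) (fun x => (cmod (f x) ^+ 2)%:E)
  mh (measurable_cst _) pointwise dominating dominated.
by rewrite integral0; apply.
Qed.

Lemma coef_trunc N f l x : base_itv a x ->
  coef a (trunc N f) l x = if l \in irange N then coef a f l x else 0.
Proof.
rewrite /base_itv/= in_itv/= => /andP[x1 xa].
rewrite /coef /trunc mem_irange; have x0 : 0 < x := lt_le_trans ltr01 x1.
rewrite (_ : (a ^ l * x \in _) = (`|l| <= N%:Z)); first by case: ifP;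
  rewrite ?mulr0.
have al : a ^ l <= a ^ l * x by rewrite ler_peMr// ltW// exprz_gt0.
have ar : a ^ l * x < a ^ (l + 1).
  by rewrite expfzDr ?gt_eqF// expr1z ltr_pM2l ?exprz_gt0.
rewrite in_itv/= ler_norml; apply/andP/andP => -[h1 h2].
  have h3 := le_lt_trans h1 ar; rewrite ltr_eXz2l// in h3.
  have h4 := le_lt_trans al h2; rewrite ltr_eXz2l// in h4.
  by split; lia.
split; first by apply: le_trans al; rewrite ler_eXz2l.
by apply: lt_le_trans ar _; rewrite ler_eXz2l//; lia.
Qed.

(** Multiplication by a mode shifts the frequencies -N, ..., N by j, and M terms
    are enough to contain the shifted range. *)
Lemma theta_psum_trunc N M m j f x xi : base_itv a x -> (N + absz j <= M)%N ->
  theta_psum a (atom m j (trunc N f)) M x xi =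
  Lambda a m x * fmode (- j) xi * theta_psum a f N x xi.
Proof.
move=> xb NM; have x0 : 0 < x by apply/Rpos_gt0; exact: base_itv_pos xb.
rewrite !theta_psumE.
under eq_bigr do rewrite coef_atom// -mulrA.
rewrite -mulr_sumr -mulrA; congr (_ * _); rewrite mulr_sumr.
pose G l := if l \in irange N then fmode (- j) xi * (coef a f l x * fmode l xi)
  else 0.
transitivity (\sum_(l <- map (+%R^~ j) (irange M)) G l).
  rewrite [RHS]big_map; apply: eq_bigr => l _; rewrite /G coef_trunc//.
  by case: ifP; rewrite ?mul0r// mulrCA -fmodeD (_ : - j + (l + j) = l)//; lia.
rewrite /G -big_mkcond -big_filter.
apply: perm_big; apply: uniq_perm.
- by rewrite filter_uniq// map_inj_uniq ?irange_uniq//; exact: addIr.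
- exact: irange_uniq.
move=> l; rewrite mem_filter; apply/andP/idP => [[]//|lN]; split => //.
apply/mapP; exists (l - j); last by rewrite subrK.
by move: lN; rewrite !mem_irange; lia.
Qed.

End atoms.

(** * The transform is an isometry *)

Section synthesis.
Context {R : realType}.
Local Notation mu := (@lebesgue_measure R).
Local Notation mu2 := (@lebesgue_measure R \x @lebesgue_measure R)%E.
Variable a : R.
Hypothesis a1 : 1 < a.
Variables (I : eqType) (s : seq I) (c : I -> R[i]) (m j : I -> int).
Variables (f : I -> R -> R[i]) (F : I -> R * R -> R[i]).
Hypotheses (fL2 : forall i, L2 (f i)) (Ff : forall i, is_theta a (f i) (F i)).

Let a0 : 0 < a. Proof. exact: lt_trans a1. Qed.

Let mode i (p : R * R) : R[i] := Lambda a (m i) p.1 * fmode (- j i) p.2.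

Let mode_measurable i : cmeasurable (theta_cell a) (mode i).
Proof.
apply: cmeasurableM.
  apply: (cmeasurable_comp (h := Lambda a (m i)) (E := setT) (u := fst)) => //.
    exact: measurable_funTS measurable_fst.
  exact: Lambda_measurable.
by apply: fmode_measurable; exact: measurable_funTS measurable_snd.
Qed.

Let cmod_mode i p : cmod (mode i p) ^+ 2 = (a - 1)^-1.
Proof. by rewrite /mode cmodM exprMn cmod_Lambda// cmod_fmode mulr1. Qed.

Let approx N x := \sum_(i <- s) c i * atom a (m i) (j i) (trunc a N (f i)) x.

Let approx_measurable N : cmeasurable Rpos (approx N).
Proof.
apply: cmeasurable_sum => i; apply: cmeasurableM; first exact: cmeasurable_cst.
by apply: atom_measurable => //; apply: trunc_measurable; case: (fL2 i).
Qed.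

Let approx_theta N p :=
  \sum_(i <- s) c i * (mode i p * theta_psum a (f i) N p.1 p.2).

Let approx_theta_measurable N : cmeasurable (theta_cell a) (approx_theta N).
Proof.
apply: cmeasurable_sum => i; apply: cmeasurableM; first exact: cmeasurable_cst.
apply: cmeasurableM => //; apply: theta_cell_measurable.
by apply: theta_psum_measurable => //; case: (fL2 i).
Qed.

Let bigM N : {M : nat | (N <= M)%N & forall i, i \in s ->
  (N + absz (j i) <= M)%N}.
Proof.
exists (N + \sum_(i <- s) absz (j i))%N; first exact: leq_addr.
by move=> i si; rewrite leq_add2l (big_rem i)//= leq_addr.
Qed.

Let approx_support N M x : (forall i, i \in s -> (N + absz (j i) <= M)%N) ->
  Rpos x -> x \notin `[a ^ (- M%:Z), a ^ M.+1%:Z[ -> approx N x = 0.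
Proof.
move=> NM /Rpos_gt0 x0 xM; rewrite /approx big_seq big1// => i si.
rewrite /atom /dilation /trunc ifF ?mulr0//; apply/negP.
rewrite in_itv/= => /andP[h1 h2]; move/negP: xM; apply.
have c0 : 0 < a ^ (- j i) by rewrite exprz_gt0.
have E : a ^ (- j i) * (a ^ j i * x) = x.
  by rewrite mulrA -expfzDr ?gt_eqF// addNr expr0z mul1r.
have jM := NM i si.
rewrite -(ler_pM2l c0) E -expfzDr ?gt_eqF// in h1.
rewrite -(ltr_pM2l c0) E -expfzDr ?gt_eqF// in h2.
rewrite in_itv/=; apply/andP; split.
  by apply: le_trans h1; rewrite ler_eXz2l//; lia.
by apply: lt_le_trans h2 _; rewrite ler_eXz2l//; lia.
Qed.

(** For functions supported in finitely many dilates of the fundamental domain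
    all series are finite sums, so the isometry is the finite Parseval identity
    on each fibre followed by the tiling of the half line. *)
Let approx_isometry N : sqn mu Rpos (approx N)
  = sqn mu2 (theta_cell a) (approx_theta N).
Proof.
have [M NM NMj] := bigM N.
rewrite (sqn_theta_cell (approx_theta_measurable N)).
transitivity (\int[mu]_(x in base_itv a) (energy a (approx N) M x)%:E)%E;
  last first.
  apply: eq_integral => x /set_mem xb; rewrite -sqn_theta_psum;
    apply: eq_sqn => xi _.
  rewrite theta_psumE; under eq_bigr do rewrite coef_lincomb mulr_suml.
  rewrite exchange_big/= /approx_theta big_seq [RHS]big_seq;
    apply: eq_bigr => i si.
  under eq_bigr do rewrite -mulrA.
  by rewrite -mulr_sumr -theta_psumE (theta_psum_trunc _ _ _ _ xb (NMj _ si)).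
rewrite base_itvE integral_energy// !mulr1 /sqn.
rewrite integral_mkcond [RHS]integral_mkcond; apply: eq_integral => x _.
rewrite !patchE; case: ifPn => [/set_mem xp|xp].
  case: ifPn => //; rewrite notin_setE => /negP xM.
  by rewrite (approx_support NMj xp xM) cmod0 expr0n.
rewrite ifF//; apply: contraNF xp => /set_mem/=;
  rewrite in_itv/= => /andP[xM _].
by apply/mem_set/Rpos_gt0; apply: lt_le_trans xM; rewrite exprz_gt0.
Qed.

(** The identity holds for truncated functions; both sides pass to the limit
    because truncations converge on the half line and partial sums converge on
    the fundamental cell. *)
Theorem synthesis_isometry :
  sqnorm (fun x => \sum_(i <- s) c i * atom a (m i) (j i) (f i) x) =
  sqn mu2 (theta_cell a) (fun p => \sum_(i <- s)
    c i * (Lambda a (m i) p.1 * fmode (- j i) p.2 * F i p)).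
Proof.
apply: (@cvgL2_eq_norm R _ _ (measurableTypeR R) (measurableTypeR R *
  measurableTypeR R)%type
   mu mu2 Rpos (theta_cell a) approx _ approx_theta).
- exact: measurable_Rpos.
- exact: measurable_theta_cell.
- apply: cvgL2_sum; first exact: measurable_Rpos.
  move=> i; apply: (@cvgL2M R _ (measurableTypeR R) mu Rpos _ (cmod (c i) ^+
    2)) => //.
  + exact: measurable_Rpos.
  + by apply: atom_cvgL2 => //; exact: trunc_cvgL2.
- apply: cvgL2_sum; first exact: measurable_theta_cell.
  move=> i; apply: (@cvgL2M R _ (measurableTypeR R * measurableTypeR R)%type
      mu2 (theta_cell a) _ (cmod (c i) ^+ 2)) => //.
  + exact: measurable_theta_cell.
  apply: (@cvgL2M R _ (measurableTypeR R * measurableTypeR R)%type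
      mu2 (theta_cell a) _ (a - 1)^-1) => //.
  + exact: measurable_theta_cell.
  + exact (mode_measurable i).
  + by move=> p _; rewrite -(cmod_mode i p).
  + exact: theta_psum_cvgL2.
- exact: approx_isometry.
Qed.

End synthesis.

(** * The half-line Hilbert space *)

Section half_line_hilbert.
Context {R : realType}.
Local Notation mu := (@lebesgue_measure R).
Implicit Types (f g : R -> R[i]) (z : R[i]) (t : R).

Definition norm2 f : R := fine (sqnorm f).
Definition rinner f g : R :=
  \int[mu]_(x in Rpos) complex.Re (f x * conjc (g x)).

Lemma L2_fin f : L2 f -> sqnorm f = (norm2 f)%:E.
Proof.
by move=> [_ fin]; rewrite fineK// ge0_fin_numE//; exact: sqn_ge0.
Qed.

Lemma L2_integrable f : L2 f ->
  mu.-integrable Rpos (EFin \o (fun x => cmod (f x) ^+ 2)).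
Proof.
move=> [mf fin]; apply/integrableP; split; first exact (measurable_ecmod2 mf).
by under eq_integral do rewrite gee0_abs ?lee_fin ?cmod2_ge0//.
Qed.

Lemma L2_scale z f : L2 f -> L2 (fun x => z * f x).
Proof.
move=> [mf fin]; split.
  by apply: cmeasurableM => //; exact: cmeasurable_cst.
apply: (@le_lt_trans _ _ ((cmod z ^+ 2)%:E * sqnorm f)%E).
  apply: (@le_sqn R _ (measurableTypeR R) mu Rpos measurable_Rpos).
  - exact: cmod2_ge0.
  - exact (cmeasurableM (cmeasurable_cst _ _) mf).
  - exact mf.
  - by move=> x _; rewrite cmodM exprMn.
by rewrite lte_mul_pinfty// lee_fin cmod2_ge0.
Qed.

Lemma L2_add f g : L2 f -> L2 g -> L2 (fun x => f x + g x).
Proof.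
move=> fL2 gL2; have [mf _] := fL2; have [mg _] := gL2; split.
  exact: cmeasurableD.
apply: le_lt_trans.
  exact (@sqnD_le R _ (measurableTypeR R) mu Rpos measurable_Rpos _ _ mf mg).
have -> : sqn mu Rpos f = (norm2 f)%:E by exact: L2_fin.
have -> : sqn mu Rpos g = (norm2 g)%:E by exact: L2_fin.
by rewrite -!EFinM -EFinD ltry.
Qed.

Lemma L2_zero : L2 (fun=> 0 : R[i]).
Proof.
split; first exact: cmeasurable_cst.
by rewrite /sqnorm integral0_eq// => x _; rewrite cmod0 expr0n.
Qed.

Lemma L2_lincomb I (s : seq I) (c : I -> R[i]) (e : I -> R -> R[i]) :
  (forall i, L2 (e i)) -> L2 (fun x => \sum_(i <- s) c i * e i x).
Proof.
move=> eL2; elim: s => [|i s ih].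
  by under eq_fun do rewrite big_nil; exact: L2_zero.
by under eq_fun do rewrite big_cons; apply: L2_add => //; exact: L2_scale.
Qed.

Lemma inner_integrable f g : L2 f -> L2 g ->
  mu.-integrable Rpos (EFin \o (fun x => complex.Re (f x * conjc (g x)))) /\
  mu.-integrable Rpos (EFin \o (fun x => complex.Im (f x * conjc (g x)))).
Proof.
move=> fL2 gL2; have [mf _] := fL2; have [mg _] := gL2.
have [m1 m2] := cmeasurableM mf (cmeasurable_conj mg).
have fg : mu.-integrable Rpos
   ((EFin \o (fun x => cmod (f x) ^+ 2)) \+ (EFin \o (fun x => cmod (g x) ^+
     2))).
  by apply: integrableD; [exact: measurable_Rpos|exact: L2_integrable|exact:
    L2_integrable].
have bd (y : R) x : `|y| <= cmod (f x * conjc (g x)) ->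
    (`|y%:E| <= `|(cmod (f x) ^+ 2)%:E + (cmod (g x) ^+ 2)%:E|)%E.
  rewrite cmodM cmod_conj -EFinD !abse_EFin lee_fin => /le_trans; apply.
  rewrite ger0_norm ?addr_ge0 ?cmod2_ge0//.
  by have := sqr_ge0 (cmod (f x) - cmod (g x)); have := cmod2_ge0 (f x);
    have := cmod2_ge0 (g x); nra.
by split; apply: le_integrable fg;
  [exact: measurable_Rpos|exact/measurable_EFinP|move=> x _; apply: bd;
    exact: le_Re_cmod
  |exact: measurable_Rpos|exact/measurable_EFinP|move=> x _; apply: bd;
    exact: le_Im_cmod].
Qed.

Lemma rinner_self f : rinner f f = norm2 f.
Proof. by congr fine; apply: eq_integral => x _; rewrite -cmod2_Re. Qed.

Lemma rinner_lincomb I (s : seq I) (c : I -> R[i]) (e : I -> R -> R[i]) f :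
  L2 f -> (forall i, L2 (e i)) ->
  rinner f (fun x => \sum_(i <- s) c i * e i x) =
  \sum_(i <- s) complex.Re (conjc (c i) * inner f (e i)).
Proof.
move=> fL2 eL2.
have lin z g : L2 g -> rinner f (fun x => z * g x)
  = complex.Re (conjc z * inner f g).
  move=> gL2; have [i1 i2] := inner_integrable fL2 gL2.
  rewrite /rinner (@eq_Rintegral _ (measurableTypeR R) R mu Rpos (fun x =>
     complex.Re z * complex.Re (f x * conjc (g x)) +
     complex.Im z * complex.Im (f x * conjc (g x)))); last first.
    move=> x _; rewrite rmorphM/= mulrCA cReM.
    by case: z => u v/=; rewrite mulNr opprK.
  rewrite RintegralD//; last 3 first.
  - exact: measurable_Rpos.
  - by apply: (integrableZl _ (complex.Re z)) i1; exact: measurable_Rpos.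
  - by apply: (integrableZl _ (complex.Im z)) i2; exact: measurable_Rpos.
  rewrite !RintegralZl//; [|exact: measurable_Rpos|exact: measurable_Rpos].
  by rewrite cReM; case: z => u v/=; rewrite mulNr opprK.
elim: s => [|i s ih].
  rewrite big_nil /rinner (@eq_Rintegral _ (measurableTypeR R) R mu Rpos (fun=>
    0)).
    by rewrite Rintegral_cst ?mul0r//; exact: measurable_Rpos.
  by move=> x _; rewrite big_nil conjc0 mulr0.
rewrite big_cons -ih -lin// /rinner.
have [i1 _] := inner_integrable fL2 (L2_scale (c i) (eL2 i)).
have [i2 _] := inner_integrable fL2 (L2_lincomb s c eL2).
rewrite -RintegralD//; last exact: measurable_Rpos.
by apply: eq_Rintegral => x _; rewrite big_cons rmorphD/= mulrDr cReD.
Qed.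

(** The squared norm of f - t g is nonnegative: this one quadratic inequality
    replaces the Cauchy-Schwarz inequality in all duality arguments below. *)
Lemma norm2B_ge0 t f g : L2 f -> L2 g ->
  0 <= norm2 f - 2 * t * rinner f g + t ^+ 2 * norm2 g.
Proof.
move=> fL2 gL2; have [i1 _] := inner_integrable fL2 gL2.
have if_ := L2_integrable fL2; have ig_ := L2_integrable gL2.
have mR := @measurable_Rpos R.
have -> : norm2 f = \int[mu]_(x in Rpos) (cmod (f x) ^+ 2) by [].
have -> : norm2 g = \int[mu]_(x in Rpos) (cmod (g x) ^+ 2) by [].
have iz : mu.-integrable Rpos
    (EFin \o (fun x => 2 * t * complex.Re (f x * conjc (g x)))).
  by apply: (integrableZl _ (2 * t)) i1; exact: mR.
have ig2 : mu.-integrable Rpos (EFin \o (fun x => t ^+ 2 * cmod (g x) ^+ 2)).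
  by apply: (integrableZl _ (t ^+ 2)) ig_; exact: mR.
rewrite /rinner -!RintegralZl// -RintegralB//.
rewrite -RintegralD//; last first.
  by apply: (integrableB _ if_ iz); exact: mR.
apply: Rintegral_ge0 => x _.
case: (f x) (g x) => u v [u' v']; rewrite !cmod2E/=.
by have := sqr_ge0 (u - t * u'); have := sqr_ge0 (v - t * v'); nra.
Qed.

End half_line_hilbert.

(** * Duality between analysis and synthesis *)

Section cell_orthonormality.
Context {R : realType}.
Local Notation mu := (@lebesgue_measure R).
Local Notation mu2 := (@lebesgue_measure R \x @lebesgue_measure R)%E.
Variable a : R.
Hypothesis a1 : 1 < a.

Let b0 : 0 < a - 1. Proof. by rewrite subr_gt0. Qed.

Lemma Lambda_freq m x : base_itv a x ->
  Lambda a m x = (Num.sqrt (a - 1))^-1%:C * cexp_i (freq (a - 1) m x).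
Proof. by move=> xb; rewrite Lambda_itv. Qed.

Lemma sqn_modulations (r : seq int) (c : int -> R[i]) : uniq r ->
  sqn mu (base_itv a) (fun x => \sum_(m <- r) c m * Lambda a m x) =
  (\sum_(m <- r) cmod (c m) ^+ 2)%:E.
Proof.
move=> ur; pose w : R[i] := (Num.sqrt (a - 1))^-1%:C.
have w2 : cmod w ^+ 2 = (a - 1)^-1.
  by rewrite cmod_real exprVn sqr_sqrtr// ltW.
transitivity (\int[mu]_(x in [set` `[1%R, (1 + (a - 1))%R[])
  (cmod (\sum_(m <- r) (c m * w) * cexp_i (freq (a - 1) m x)) ^+ 2)%:E)%E.
  rewrite addrC subrK; apply: eq_integral => x /set_mem xb.
  by congr (cmod _ ^+ 2)%:E; apply: eq_bigr => m _; rewrite Lambda_freq// mulrA.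
rewrite trig_orthogonality//; congr EFin; rewrite mulr_sumr;
  apply: eq_bigr => m _.
by rewrite cmodM exprMn w2 mulrCA mulfV ?mulr1// gt_eqF.
Qed.

Lemma sqn_fmodes (r : seq int) (h : int -> R[i]) : uniq r ->
  sqn mu period_itv (fun xi => \sum_(j <- r) h j * fmode (- j) xi) =
  (\sum_(j <- r) cmod (h j) ^+ 2)%:E.
Proof.
move=> ur; have := @fourier_parseval R (map -%R r) (fun l => h (- l)).
rewrite map_inj_uniq; last exact: oppr_inj.
move=> /(_ ur); rewrite big_map.
under [in X in _ -> X]eq_bigr do rewrite -[X in h X]opprK.
move=> <-; apply: eq_integral => xi _; rewrite big_map.
by under [in RHS]eq_bigr do rewrite opprK.
Qed.

Lemma cell_mode_measurable m j :
  cmeasurable (theta_cell a) (fun p => Lambda a m p.1 * fmode (- j) p.2).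
Proof.
apply: cmeasurableM.
  apply: (cmeasurable_comp (h := Lambda a m) (E := setT) (u := fst)) => //.
    exact: measurable_funTS measurable_fst.
  exact: Lambda_measurable.
by apply: fmode_measurable; exact: measurable_funTS measurable_snd.
Qed.

Lemma cell_poly_measurable (r r' : seq int) (c : int -> int -> R[i]) :
  cmeasurable (theta_cell a) (fun p =>
    \sum_(m <- r) \sum_(j <- r') c m j * (Lambda a m p.1 * fmode (- j) p.2)).
Proof.
apply: cmeasurable_sum => m; apply: cmeasurable_sum => j.
apply: cmeasurableM; first exact: cmeasurable_cst.
exact: cell_mode_measurable.
Qed.

(** Orthonormality of the modes of the cell, obtained by integrating first in xi
    and then in x. *)
Lemma sqn_cell_poly (r r' : seq int) (c : int -> int -> R[i]) :
  uniq r -> uniq r' ->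
  sqn mu2 (theta_cell a) (fun p =>
    \sum_(m <- r) \sum_(j <- r') c m j * (Lambda a m p.1 * fmode (- j) p.2)) =
  (\sum_(m <- r) \sum_(j <- r') cmod (c m j) ^+ 2)%:E.
Proof.
move=> ur ur'; rewrite (sqn_theta_cell (cell_poly_measurable r r' c)).
pose h (x : R) j := \sum_(m <- r) c m j * Lambda a m x.
transitivity (\int[mu]_(x in base_itv a) \sum_(j <- r') (cmod (h x j) ^+
  2)%:E)%E.
  apply: eq_integral => x _; rewrite sumEFin -sqn_fmodes//;
    apply: eq_sqn => xi _ /=.
  rewrite exchange_big/=; apply: eq_bigr => j _; rewrite mulr_suml.
  by apply: eq_bigr => m _; rewrite mulrA.
rewrite ge0_integral_sum//; last 3 first.
- exact: measurable_base_itv.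
- move=> j; apply: measurable_ecmod2; apply: cmeasurable_sum => m.
  apply: cmeasurableM; first exact: cmeasurable_cst.
  by apply: cmeasurableS (Lambda_measurable _ _).
- by move=> j x _; rewrite lee_fin cmod2_ge0.
rewrite [in RHS]exchange_big/= -sumEFin; apply: eq_bigr => j _.
exact: sqn_modulations.
Qed.

End cell_orthonormality.

Section duality.
Context {R : realType}.
Local Notation mu := (@lebesgue_measure R).
Local Notation mu2 := (@lebesgue_measure R \x @lebesgue_measure R)%E.
Variable a : R.
Variables (L : nat) (psi : 'I_L -> R -> R[i]).
Variable B : R.

Definition label := (int * int * 'I_L)%type.

Definition labels (r r' : seq int) : seq label :=
  [seq (mj, l) | mj <- [seq (m, j) | m <- r, j <- r'], l <- enum 'I_L].

Lemma big_labels (V : nmodType) r r' (G : label -> V) :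
  \sum_(i <- labels r r') G i =
  \sum_(m <- r) \sum_(j <- r') \sum_(l < L) G (m, j, l).
Proof.
by rewrite big_allpairs_dep big_allpairs_dep; apply: eq_bigr => m _;
  apply: eq_bigr => j _; rewrite big_enum.
Qed.

Definition MDatom (i : label) : R -> R[i] := MD psi a i.1.1 i.1.2 i.2.

Definition combine (s : seq label) (c : label -> R[i]) : R -> R[i] :=
  fun x => \sum_(i <- s) c i * MDatom i x.

Lemma bessel_MD_finite r r' f : bessel_MD psi a B -> uniq r -> uniq r' ->
  L2 f ->
  \sum_(i <- labels r r') cmod (inner f (MDatom i)) ^+ 2 <= B * norm2 f.
Proof.
move=> bes ur ur' fL2; have := bes f fL2; rewrite (L2_fin fL2) -EFinM => H.
rewrite -lee_fin -sumEFin; apply: le_trans H.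
rewrite big_labels.
under eq_bigr do rewrite exchange_big/=.
rewrite exchange_big/=; apply: lee_sum => l _.
apply: esum_ge; exists [set` [seq (m, j) | m <- r, j <- r']].
  by split => //; exact: finite_seq.
rewrite -fsbig_seq; first by rewrite big_allpairs.
by apply: allpairs_uniq => // -[? ?] [? ?].
Qed.

(** Every finite set of index pairs lies in a square of indices, and the terms
    are nonnegative. *)
Lemma bessel_MD_of_finite :
  (forall N f, L2 f -> \sum_(i <- labels (irange N) (irange N))
      cmod (inner f (MDatom i)) ^+ 2 <= B * norm2 f) ->
  bessel_MD psi a B.
Proof.
move=> H f fL2; rewrite -esum_sum; last by move=> *; rewrite lee_fin cmod2_ge0.
rewrite (L2_fin fL2) -EFinM; apply: ge_ereal_sup => _ [X [finX _] <-].
rewrite fsbig_finite//.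
have uX : uniq (finmap.enum_fset (fset_set X)) by exact: finmap.fset_uniq.
set sX : seq (int * int) := finmap.enum_fset _ in uX *.
pose N := (\sum_(p <- sX) (absz p.1 + absz p.2))%N.
apply: (@le_trans _ _ (\sum_(i <- labels (irange N) (irange N))
   cmod (inner f (MDatom i)) ^+ 2)%:E); last by rewrite lee_fin; exact: H.
rewrite big_labels.
rewrite (_ : \sum_(m <- _) _ = \sum_(mj <- [seq (m, j) | m <- irange N,
  j <- irange N])
  \sum_(l < L) cmod (inner f (MDatom (mj, l))) ^+ 2);
    last by rewrite big_allpairs.
under eq_bigr do rewrite sumEFin.
rewrite sumEFin lee_fin.
set s := [seq (m, j) | m <- _, j <- _].
have us : uniq s.
  by apply: allpairs_uniq => [||[? ?] [? ?]//]; exact: irange_uniq.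
have sub : {subset sX <= s}.
  move=> p pX; have pN : (absz p.1 + absz p.2 <= N)%N.
    by rewrite /N (big_rem p)//= leq_addr.
  apply/allpairsP; exists p; rewrite !mem_irange; split; [lia|lia|].
  by case: p {pX pN}.
rewrite [leRHS](bigID (mem sX)) -[leLHS]addr0; apply: lerD; last first.
  by apply: sumr_ge0 => p _; apply: sumr_ge0 => l _; exact: cmod2_ge0.
rewrite -big_filter le_eqVlt; apply/orP; left; apply/eqP.
apply: perm_big; apply: uniq_perm; rewrite ?filter_uniq //.
move=> p; rewrite mem_filter; apply/idP/andP => [pX|[]//].
by split => //; exact: sub.
Qed.

Hypothesis a1 : 1 < a.
Hypothesis psi_L2 : forall l, L2 (psi l).
Hypothesis B0 : 0 < B.

Lemma atom_L2 m j f : L2 f -> L2 (atom a m j f).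
Proof.
move=> fL2; split; last exact: sqn_atom_lty.
by apply: atom_measurable => //; case: fL2.
Qed.

Lemma MDatom_L2 i : L2 (MDatom i).
Proof. exact: (atom_L2 i.1.1 i.1.2 (psi_L2 i.2)). Qed.

Lemma combine_L2 s c : L2 (combine s c).
Proof. by apply: L2_lincomb => i; exact: MDatom_L2. Qed.

(** Take for coefficients c the analysis coefficients of f, with square sum S,
    and let g be the combination they define.  The inner product of f and g is
    S and |g|^2 <= B S, so 0 <= |f - g / B|^2 <= |f|^2 - S / B. *)
Lemma bessel_finite s f : L2 f ->
  (forall c, norm2 (combine s c) <= B * \sum_(i <- s) cmod (c i) ^+ 2) ->
  \sum_(i <- s) cmod (inner f (MDatom i)) ^+ 2 <= B * norm2 f.
Proof.
move=> fL2 bnd; pose c i := inner f (MDatom i).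
set S := \sum_(i <- s) _.
have rS : rinner f (combine s c) = S.
  rewrite /combine rinner_lincomb//; last exact: MDatom_L2.
  by apply: eq_bigr => i _; rewrite mulrC -cmod2_Re.
have := norm2B_ge0 B^-1 fL2 (combine_L2 s c); rewrite rS.
have := bnd c; rewrite -/S; set n := norm2 (combine _ _); set nf := norm2 f.
move=> nS; have BB : B * B^-1 = 1 by rewrite mulfV ?gt_eqF.
have Bi : 0 < B^-1 by rewrite invr_gt0.
have h1 : B^-1 ^+ 2 * n <= B^-1 * S.
  have := ler_wpM2l (ltW (exprn_gt0 2 Bi)) nS.
  by rewrite mulrA (_ : B^-1 ^+ 2 * B
    = B^-1)// expr2 -mulrA mulVf ?mulr1// gt_eqF.
move=> h2; have h3 : B^-1 * S <= nf by lra.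
have := ler_wpM2l (ltW B0) h3.
by rewrite mulrA BB mul1r.
Qed.

(** The squared norm of the combination g is the inner product of its
    coefficients with its analysis coefficients w; by the inequality
    2 |c w| <= B |c|^2 + |w|^2 / B it is at most (B |c|^2 + |g|^2) / 2. *)
Lemma synthesis_bound_of_bessel s c : 
  (forall f, L2 f -> \sum_(i <- s) cmod (inner f (MDatom i)) ^+ 2
    <= B * norm2 f) ->
  norm2 (combine s c) <= B * \sum_(i <- s) cmod (c i) ^+ 2.
Proof.
move=> bes; set g := combine s c; have gL2 : L2 g by exact: combine_L2.
have E : norm2 g = \sum_(i <- s) complex.Re (conjc (c i) * inner g (MDatom i)).
  by rewrite -rinner_self {2}/g /combine rinner_lincomb//; exact: MDatom_L2.
have BB : B * B^-1 = 1 by rewrite mulfV ?gt_eqF.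
have Bi : 0 < B^-1 by rewrite invr_gt0.
have le1 : norm2 g <= \sum_(i <- s)
    (2^-1 * B * cmod (c i) ^+ 2 + 2^-1 * B^-1 * cmod (inner g (MDatom i)) ^+ 2).
  rewrite {1}E; apply: ler_sum => i _.
  rewrite !cmod2E; case: (c i) (inner g _) => u v [u' v'] /=.
  rewrite mulNr opprK.
  have H (x y : R) : x * y <= 2^-1 * B * x ^+ 2 + 2^-1 * B^-1 * y ^+ 2.
    have := mulr_ge0 (ltW B0) (sqr_ge0 (x - B^-1 * y)).
    have -> : B * (x - B^-1 * y) ^+ 2 =
      B * x ^+ 2 - 2 * (B * B^-1) * x * y + (B * B^-1) * B^-1 * y ^+ 2 by ring.
    rewrite BB; lra.
  by have := H u u'; have := H v v'; lra.
rewrite big_split/= -!mulr_sumr in le1.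
have := bes g gL2; set W := \sum_(i <- s) cmod (inner _ _) ^+ 2 in le1 *.
move=> WB; have : B^-1 * W <= norm2 g.
  by have := ler_wpM2l (ltW Bi) WB; rewrite mulrA mulVf ?gt_eqF// mul1r.
by lra.
Qed.

(** The squared norm of a finite combination, computed on the transform side. *)
Lemma norm2_combine (F : 'I_L -> R * R -> R[i]) s c :
  (forall l, is_theta a (psi l) (F l)) ->
  (norm2 (combine s c))%:E = sqn mu2 (theta_cell a) (fun p => \sum_(i <- s)
    c i * (Lambda a i.1.1 p.1 * fmode (- i.1.2) p.2 * F i.2 p)).
Proof.
move=> FT; rewrite -L2_fin; last exact: combine_L2.
exact: (@synthesis_isometry _ _ a1 _ s c (fun i : label => i.1.1)
  (fun i : label => i.1.2) (fun i : label => psi i.2) (fun i : label => F i.2)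
  (fun i => psi_L2 i.2) (fun i => FT i.2)).
Qed.

End duality.

(** * Concentrating kernels *)

Section interval_averages.
Context {R : realType}.
Local Notation mu := (@lebesgue_measure R).

(** At a Lebesgue point the value of g is the limit of its averages over small
    balls, and the trace of a ball on the interval is again an interval. *)
Lemma ae_le_of_interval_averages (s e K : R) (g : R -> R) : 0 <= K ->
  mu.-integrable [set` `]s, e[] (EFin \o g) ->
  (forall u v, s <= u -> u < v -> v <= e ->
     (\int[mu]_(x in [set` `]u, v[]) (g x)%:E <= (K * (v - u))%:E)%E) ->
  {ae mu, forall x, [set` `]s, e[] x -> g x <= K}.
Proof.
move=> K0 ig H; set O := [set` `]s, e[] in ig *.
have mO : measurable O by exact: measurable_itv.
pose f := g \_ O.
have locf : locally_integrable setT f by exact: integrable_locally.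
have rpos (n : nat) : 0 < n.+1%:R^-1 :> R by rewrite invr_gt0.
pose r (n : nat) : {posnum R} := PosNum (rpos n).
pose E (x : R) n := ball x (r n)%:num.
have nE x : nicely_shrinking x (E x).
  split; first by move=> n; exact: measurable_ball.
  exists (1, r); split => //=.
  - exact: cvg_harmonic.
  - by move=> n; rewrite /E.
  - by move=> n; rewrite mul1e.
have := lebesgue_differentiation locf; apply: ae_imp => x fx xO.
have := nice_lebesgue_differentiation nE locf fx.
rewrite /f patchE mem_set// -lee_fin => lim; apply: (cvge_to_le lim).
apply: nearW => n; rewrite /E lebesgue_measure_ball//.
set d := (r n)%:num; have d0 : 0 < d := rpos n.
rewrite inver ifF; last by rewrite gt_eqF// mulrn_wgt0.
rewrite lee_pdivrMl ?mulrn_wgt0// -EFinM.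
rewrite (_ : (\int[_]_(_ in _) _)%E
  = \int[mu]_(y in ball x d `&` O) (g y)%:E)%E; last first.
  by rewrite integral_mkcondr; apply: eq_integral => y _; rewrite restrict_EFin.
rewrite ball_itv (_ : _ `&` O =
    [set` `]Num.max (x - d) s, Num.min (x + d) e[]); last first.
  apply/seteqP; split => y; rewrite /O/= !in_itv/= gt_max lt_min.
    by move=> [/andP[-> ->] /andP[-> ->]].
  by move=> /andP[/andP[-> ->] /andP[-> ->]].
have [uv|vu] := ltP (Num.max (x - d) s) (Num.min (x + d) e); last first.
  have -> : [set` `]Num.max (x - d) s, Num.min (x + d) e[] = set0.
    by apply: set_itv_ge; rewrite bnd_simp -leNgt.
  by rewrite integral_set0 lee_fin mulr_ge0// mulrn_wge0// ltW.
apply: le_trans; first by apply: H => //;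
  [rewrite le_max lexx orbT|rewrite ge_min lexx orbT].
rewrite lee_fin mulrC ler_wpM2r//.
have : Num.min (x + d) e <= x + d by rewrite ge_min lexx.
have : x - d <= Num.max (x - d) s by rewrite le_max lexx.
by rewrite mulr2n; lra.
Qed.

End interval_averages.

Section concentrating_kernel.
Context {R : realType}.
Local Notation mu := (@lebesgue_measure R).
Variables (s b : R).
Hypothesis b0 : 0 < b.
Implicit Types (x t y : R) (n : nat).

(** The kernel is |((1 + e(y/b)) / 2)^n|^2: being the square modulus of a
    trigonometric polynomial, it is a legitimate test function for the Bessel
    inequality, and it concentrates at 0 modulo b. *)
Definition kern n y : R := ((1 + cos (freq b 1 y)) / 2) ^+ n.

Lemma kern_ge0 n y : 0 <= kern n y.
Proof. by apply: exprn_ge0; have := cos_geN1 (freq b 1 y); lra. Qed.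

Lemma kern_even n x t : kern n (x - t) = kern n (t - x).
Proof.
rewrite /kern (_ : freq b 1 (t - x) = - freq b 1 (x - t)) ?cosN//.
by rewrite /freq; ring.
Qed.

Lemma kern_continuous n : continuous (kern n).
Proof.
move=> y; apply: (@continuous_comp _ _ _ (fun y => (1
  + cos (freq b 1 y)) / 2) (fun z => z ^+ n)).
  apply: cvgM; last exact: cvg_cst.
  apply: cvgD; first exact: cvg_cst.
  apply: continuous_comp; last exact: continuous_cos.
  apply: cvgM; last exact: cvg_cst.
  by apply: cvgM; [exact: cvg_cst|exact: cvg_id].
exact: exprn_continuous.
Qed.

Lemma kern_measurable n d (T : measurableType d) (D : set T) (f : T -> R) :
  measurable_fun D f -> measurable_fun D (fun z => kern n (f z)).
Proof.
move=> mf; apply: (measurableT_comp (f := kern n)) => //.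
by apply: continuous_measurable_fun; exact: kern_continuous.
Qed.

Definition nat_freqs n : seq int := [seq k%:Z | k <- iota 0 n.+1].

Lemma nat_freqs_uniq n : uniq (nat_freqs n).
Proof. by rewrite map_inj_uniq ?iota_uniq// => k l []. Qed.

Definition kern_coef n t (k : int) : R[i] :=
  ('C(n, absz k)%:R / 2 ^+ n)%:C * cexp_i (- freq b k t).

(** Expand the n-th power of (1 + e((x - t) / b)) / 2 by the binomial theorem. *)
Lemma kern_poly n x t :
  kern n (x - t) = cmod (\sum_(k <- nat_freqs n) kern_coef n t k * cexp_i (freq
    b k x)) ^+ 2.
Proof.
pose w := cexp_i (freq b 1 (x - t)) : R[i].
have expw k : cexp_i (- freq b k%:Z t) * cexp_i (freq b k%:Z x) = w ^+ k.
  rewrite -cexp_iD /w; elim: k => [|k ih].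
    by rewrite /freq !(mulr0, mul0r) oppr0 addr0 /cexp_i cos0 sin0.
  rewrite exprS -ih -cexp_iD; congr cexp_i.
  by rewrite /freq -[k.+1%:Z]/(1 + k%:Z) intrD; ring.
rewrite (_ : \sum_(k <- _) _ = ((2^-1)%:C * (1 + w)) ^+ n); last first.
  rewrite exprMn exprDn mulr_sumr big_map -(subn0 n.+1).
  rewrite -/(index_iota 0 _) big_mkord; apply: eq_bigr => k _.
  rewrite /kern_coef -mulrA expw expr1n mul1r -[w ^+ k *+ _]mulr_natr.
  have -> : (2^-1 : R)%:C ^+ n = (2^-1 ^+ n : R)%:C by rewrite rmorphXn.
  have -> : 'C(n, k)%:R = ('C(n, k)%:R : R)%:C by rewrite rmorph_nat.
  by rewrite rmorphM/= exprVn; ring.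
rewrite /kern; set Z := _ * (1 + w); elim: n => [|n ih];
  first by rewrite !expr0 cmod2E/= expr1n expr0n addr0.
have -> : cmod (Z ^+ n.+1) ^+ 2 = cmod Z ^+ 2 * cmod (Z ^+ n) ^+ 2.
  by rewrite [Z ^+ n.+1]exprS cmodM; ring.
rewrite exprS -ih; congr (_ * _).
rewrite /Z cmodM exprMn cmod_real cmod2E/w/=.
have := cos2Dsin2 (freq b 1 (x - t)).
set C := cos _; set S := sin _ => CS; rewrite add0r.
have -> : S ^+ 2 = 1 - C ^+ 2 by lra.
by field.
Qed.

Definition kern_mass n : R :=
  \sum_(k <- nat_freqs n) cmod (kern_coef n 0 k) ^+ 2.

Lemma kern_coef_norm n t :
  \sum_(k <- nat_freqs n) cmod (kern_coef n t k) ^+ 2 = kern_mass n.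
Proof.
by apply: eq_bigr => k _; rewrite /kern_coef !cmodM !exprMn !cmod_cexp.
Qed.

Lemma integral_kern n t :
  (\int[mu]_(x in [set` `[s,
    (s + b)%R[]) (kern n (x - t))%:E = (b * kern_mass n)%:E)%E.
Proof.
under eq_integral do rewrite kern_poly.
by rewrite trig_orthogonality ?nat_freqs_uniq// kern_coef_norm.
Qed.

Lemma integral_kern_center n x :
  (\int[mu]_(t in [set` `[s,
    (s + b)%R[]) (kern n (x - t))%:E = (b * kern_mass n)%:E)%E.
Proof. by rewrite -(integral_kern n x); apply: eq_integral => t _;
  rewrite kern_even. Qed.

Lemma freq1E z : freq b 1 z = (2 * z / b) * pi.
Proof. by rewrite /freq mulr1; ring. Qed.

Lemma freq1_itv z : 0 <= z -> 2 * z <= b -> freq b 1 z \in `[0, pi].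
Proof.
move=> z0 zb; rewrite in_itv/= freq1E mulr_ge0 ?pi_ge0//=; last first.
  by rewrite !mulr_ge0// invr_ge0 ltW.
by rewrite ler_piMl ?pi_ge0// ler_pdivrMr// mul1r.
Qed.

(** Away from the centre the kernel is at most its value at distance d. *)
Lemma kern_far n d y : 0 <= d -> d <= `|y| -> `|y| <= b - d ->
  kern n y <= kern n d.
Proof.
move=> d0 dy yd; apply: lerXn2r; rewrite ?nnegrE.
- by have := cos_geN1 (freq b 1 y); lra.
- by have := cos_geN1 (freq b 1 d); lra.
suff : cos (freq b 1 y) <= cos (freq b 1 d) by lra.
have cE : cos (freq b 1 y) = cos (freq b 1 `|y|).
  by rewrite -cos_norm /freq !mulr1 !normrM ger0_norm// [`|pi|]ger0_norm
    ?pi_ge0//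
    [`|b^-1|]ger0_norm// invr_ge0 ltW.
have bd : 0 < b^-1 by rewrite invr_gt0.
have bb : b * b^-1 = 1 by rewrite mulfV ?gt_eqF.
have mono z : d <= z -> 2 * z <= b -> cos (freq b 1 z) <= cos (freq b 1 d).
  move=> dz zb; have z0 := le_trans d0 dz.
  have [->|zd] := eqVneq z d; first by [].
  apply: ltW; rewrite ltr_cos; last 2 first.
    by apply: freq1_itv => //; lra.
  - by apply: freq1_itv => //; lra.
  rewrite !freq1E ltr_pM2r ?pi_gt0// ltr_pM2r// ltr_pM2l// lt_neqAle eq_sym
    zd//.
rewrite cE; have [yb|yb] := leP (2 * `|y|) b; first exact: mono.
rewrite (_ : cos (freq b 1 `|y|) = cos (freq b 1 (b - `|y|)));
  first by apply: mono; lra.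
rewrite -[RHS]cosN -[RHS](cosD2pi); congr cos.
by rewrite /freq mulr1 mulr2n; field; rewrite gt_eqF.
Qed.

Lemma kern_ltr d d' : 0 <= d' -> d' < d -> 2 * d <= b -> kern 1 d < kern 1 d'.
Proof.
move=> d0 dd db; rewrite /kern !expr1 ltr_pM2r// ltrD2l.
have bd : 0 < b^-1 by rewrite invr_gt0.
rewrite ltr_cos; last 2 first.
- by apply: freq1_itv => //; lra.
- by apply: freq1_itv => //; lra.
by rewrite !freq1E ltr_pM2r ?pi_gt0// ltr_pM2r// ltr_pM2l.
Qed.

End concentrating_kernel.

(** * Bounds from kernel averages *)

Lemma floor_approx {R : realType} (t : R) :
  (Num.floor (t * k.+1%:R))%:~R / k.+1%:R @[k --> \oo] --> t.
Proof.
apply/cvgrPdist_le => e e0.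
have hN := cvg_harmonic (R := R); move/cvgrPdist_le : hN => /(_ e e0).
apply: filterS => k /=; rewrite sub0r normrN => H; apply: le_trans H.
have k0 : 0 < k.+1%:R :> R by [].
have ki : 0 <= k.+1%:R^-1 :> R by rewrite invr_ge0 ltW.
rewrite [X in _ <= X]ger0_norm//.
have := floor_le (t * k.+1%:R); have := floorD1_gt (t * k.+1%:R).
set z := Num.floor _; rewrite intrD => h1 h2.
have -> : t - z%:~R / k.+1%:R = (t * k.+1%:R - z%:~R) / k.+1%:R.
  by rewrite mulrBl mulfK ?gt_eqF.
rewrite normrM [`|_^-1|]ger0_norm// ler_piMl//.
by rewrite ger0_norm; lra.
Qed.

Lemma rat_approx {R : realType} (t : R) :
  exists q : nat -> rat, ratr (q k) @[k --> \oo] --> t.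
Proof.
exists (fun k => (Num.floor (t * k.+1%:R))%:~R / k.+1%:R).
under eq_fun do rewrite fmorph_div/= ratr_int ratr_nat.
exact: floor_approx.
Qed.

Lemma le_limn_einf {R : realType} (u v : (\bar R)^nat) (l : \bar R) :
  (forall k, (v k <= u k)%E) -> v @ \oo --> l -> (l <= limn_einf u)%E.
Proof.
move=> vu /cvg_limn_einf_sup[<- _]; rewrite !limn_einf_lim.
apply: lee_lim; [exact: is_cvg_einfs|exact: is_cvg_einfs|].
apply: nearW => n; apply: le_ereal_inf_tmp => _ [k nk <-].
by apply: le_trans (vu k); apply: ereal_inf_lbound; exists k.
Qed.

Section kernel_averages.
Context {R : realType}.
Local Notation mu := (@lebesgue_measure R).
Variables (s b : R).
Hypothesis b0 : 0 < b.
Implicit Types (x t y : R) (n : nat).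

Let D : set R := [set` `[s, s + b[].
Let mD : measurable D. Proof. exact: measurable_itv. Qed.

Variables (g : R -> R) (K : R).
Hypotheses (K0 : 0 <= K) (g0 : forall x, 0 <= g x).
Hypothesis ig : mu.-integrable D (EFin \o g).
Hypothesis g_rat : forall n (q : rat),
  (\int[mu]_(x in D) (kern b n (x - ratr q) * g x)%:E
   <= (K * (b * kern_mass b n))%:E)%E.

Let mg : measurable_fun D g.
Proof. by case/integrableP : ig => /measurable_EFinP. Qed.

Let mkg n t : measurable_fun D (fun x => (kern b n (x - t) * g x)%:E).
Proof.
apply/measurable_EFinP; apply: measurable_funM => //.
by apply: kern_measurable; exact: measurable_funB.
Qed.

(** Kernels with rational centres approach the kernel centred at t pointwise, and
    Fatou's lemma keeps the bound. *)
Let g_real n t :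
  (\int[mu]_(x in D) (kern b n (x - t) * g x)%:E
    <= (K * (b * kern_mass b n))%:E)%E.
Proof.
have [q qt] := rat_approx t.
pose h k x := (kern b n (x - ratr (q k)) * g x)%:E.
apply: (@le_trans _ _ (limn_einf (fun k => \int[mu]_(x in D) h k x))%E);
  last first.
  by apply: limn_einf_le (cvg_cst _) => k; exact: g_rat.
apply: le_trans (fatou mu mD (fun k => mkg n (ratr (q k))) _); last first.
  by move=> k x _; rewrite lee_fin mulr_ge0// kern_ge0.
rewrite le_eqVlt; apply/orP; left; apply/eqP; apply: eq_integral => x _;
  apply/esym.
suff /cvg_limn_einf_sup[-> _] : (h ^~ x) @ \oo --> (kern b n (x - t) * g x)%:E
  by [].
apply: cvg_EFin; first exact: nearW.
apply: cvgM; last exact: cvg_cst.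
apply: (cvg_comp (G := nbhs (x - t)) _ (kern b n)); last exact: kern_continuous.
by apply: cvgB => //; exact: cvg_cst.
Qed.

Section one_interval.
Variables (u v : R).
Hypotheses (su : s <= u) (uv : u < v) (vb : v <= s + b).
Let I : set R := [set` `]u, v[].
Let mI : measurable I. Proof. exact: measurable_itv. Qed.
Let ID : I `<=` D.
Proof.
move=> x; rewrite /I /D/= !in_itv/= => /andP[ux xv].
by rewrite (le_trans su (ltW ux)) (lt_le_trans xv).
Qed.

Let W n x : \bar R := (\int[mu]_(t in I) (kern b n (x - t))%:E)%E.

Let W0 n x : (0 <= W n x)%E.
Proof. by apply: integral_ge0 => t _; rewrite lee_fin kern_ge0. Qed.

Let mkt n x (E : set R) : measurable_fun E (fun t => (kern b n (x - t))%:E).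
Proof.
by apply/measurable_EFinP; apply: kern_measurable; exact: measurable_funB.
Qed.

(** Integrate the kernel bound over all centres t in the interval and exchange
    the order of integration. *)
Let W_average n :
  (\int[mu]_(x in D) (W n x * (g x)%:E)
    <= (K * (v - u))%:E * (b * kern_mass b n)%:E)%E.
Proof.
have -> : (\int[mu]_(x in D) (W n x * (g x)%:E) =
    \int[mu]_(x in D) \int[mu]_(t in I) (kern b n (x - t) * g x)%:E)%E.
  apply: eq_integral => x _; rewrite -ge0_integralZr//.
  - exact: mkt.
  - by move=> t _; rewrite lee_fin kern_ge0.
  - by rewrite lee_fin.
have mjoint (E F : set R) (p1 p2 : R * R -> R) : (forall p, (E `*` F) p ->
  D (p1 p)) ->
    measurable_fun (E `*` F) p1 -> measurable_fun (E `*` F) p2 ->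
    measurable_fun (E `*` F) (fun p => (kern b n (p1 p - p2 p) * g (p1 p))%:E).
  move=> pD m1 m2; apply/measurable_EFinP; apply: measurable_funM.
    by apply: kern_measurable; exact: measurable_funB.
  by apply: (measurable_comp mD _ mg m1) => _ [p /pD pp <-].
have m12 : measurable_fun (D `*` I) (fun p => (kern b n (p.1 - p.2) * g
  p.1)%:E).
  apply: mjoint => [p []//||]; apply: measurable_funTS.
    exact: measurable_fst.
  exact: measurable_snd.
have m21 : measurable_fun (I `*` D) (fun p => (kern b n (p.2 - p.1) * g
  p.2)%:E).
  apply: mjoint => [p []//||]; apply: measurable_funTS.
    exact: measurable_snd.
  exact: measurable_fst.
have kg0 x t : (0 <= (kern b n (x - t) * g x)%:E)%E.
  by rewrite lee_fin mulr_ge0// kern_ge0.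
have swap := @tonelli_swap R _ _ (measurableTypeR R) (measurableTypeR R) mu mu
  D I mD mI
  _ m12 (fun p _ => kg0 p.1 p.2).
apply: (@le_trans _ _ (\int[mu]_(t in I) \int[mu]_(x in D)
    (kern b n (x - t) * g x)%:E)%E).
  by rewrite le_eqVlt; apply/orP; left; apply/eqP; exact: swap.
apply: (@le_trans _ _ (\int[mu]_(t in I) (cst (K * (b * kern_mass b n))%:E)
  t)%E).
  apply: ge0_le_integral => //.
  - by move=> t _; apply: integral_ge0 => x _.
  - exact (@measurable_inner_integral R _ _ (measurableTypeR R)
    (measurableTypeR R)
      mu I D mI mD _ m21 (fun p _ => kg0 p.2 p.1)).
rewrite integral_cst//= /I lebesgue_measure_itv/= lte_fin uv -EFinD -!EFinM
  lee_fin.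
by rewrite le_eqVlt; apply/orP; left; apply/eqP; ring.
Qed.

(** Inside the interval the window captures all but a geometrically small
    proportion of the mass of the kernel. *)
Let W_concentrates x : I x -> exists q, [/\ 0 <= q, q < 1 & exists C,
  forall n, ((b * kern_mass b n * (1 - C * q ^+ n))%:E <= W n x)%E].
Proof.
rewrite /I/= in_itv/= => /andP[ux xv].
have [su' vb'] : s <= u /\ v <= s + b by [].
pose d := Num.min (x - u) (v - x).
have d0 : 0 < d by rewrite lt_min; apply/andP; split; lra.
have du : d <= x - u by rewrite ge_min lexx.
have dv : d <= v - x by rewrite ge_min lexx orbT.
have d2 : 2 * d <= b by move: su vb; lra.
have klt : kern b 1 d < kern b 1 (d / 2) by apply: kern_ltr => //; lra.
have k0 : 0 < kern b 1 (d / 2) by apply: le_lt_trans klt; exact: kern_ge0.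
have kX n y : kern b n y = kern b 1 y ^+ n by rewrite /kern expr1.
exists (kern b 1 d / kern b 1 (d / 2)); split.
- by rewrite divr_ge0 ?kern_ge0.
- by rewrite ltr_pdivrMr// mul1r.
exists (b / (d / 2)) => n.
have xD : D x by apply: ID; rewrite /I/= in_itv/= ux.
have mass_ge : d / 2 * kern b n (d / 2) <= b * kern_mass b n.
  rewrite -lee_fin -(integral_kern_center s b0 n x).
  apply: (@le_trans _ _ (\int[mu]_(t in [set` `](x - d / 2)%R,
    x[]) (kern b n (x - t))%:E)%E).
    apply: (@le_trans _ _ (\int[mu]_(t in [set` `](x - d / 2)%R,
      x[]) (cst (kern b n (d / 2))%:E) t)%E).
      rewrite integral_cst//= lebesgue_measure_itv/= lte_fin ifT; last by lra.
      by rewrite -EFinD -EFinM lee_fin; rewrite le_eqVlt; apply/orP; left;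
        apply/eqP; ring.
    apply: ge0_le_integral => //.
    - by move=> t _; rewrite lee_fin kern_ge0.
    - exact: mkt.
    - move=> t; rewrite /= in_itv/= => /andP[t1 t2]; rewrite lee_fin.
      by apply: kern_far => //; rewrite ?ger0_norm; lra.
  apply: ge0_subset_integral => //.
  - exact: mkt.
  - by move=> t _; rewrite lee_fin kern_ge0.
  - by move=> t; rewrite /D/= !in_itv/= => /andP[t1 t2]; apply/andP; split; lra.
have split_mass : ((b * kern_mass b n)%:E =
    W n x + \int[mu]_(t in D `\` I) (kern b n (x - t))%:E)%E.
  rewrite -(integral_kern_center s b0 n x) -/D -{1}(setDUK ID)
    ge0_integral_setU//.
  - exact: measurableD.
  - exact: mkt.
  - by move=> t _; rewrite lee_fin kern_ge0.
  - by apply/disj_setPS => t [It [_]].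
have rest_le : (\int[mu]_(t in D `\` I) (kern b n (x - t))%:E
  <= (b * kern b n d)%:E)%E.
  apply: (@le_trans _ _ (\int[mu]_(t in D `\` I) (cst (kern b n d)%:E) t)%E).
    apply: ge0_le_integral => //.
    - exact: measurableD.
    - by move=> t _; rewrite lee_fin kern_ge0.
    - exact: mkt.
    - move=> t []; rewrite /D /I/= !in_itv/= => /andP[t1 t2] /negP.
      rewrite negb_and -!leNgt lee_fin => /orP[tu|vt].
        by apply: kern_far => //; rewrite ?ger0_norm; lra.
      by apply: kern_far => //; rewrite ?ler0_norm; lra.
  rewrite integral_cst//; last exact: measurableD.
  rewrite mulrC EFinM; apply: lee_wpmul2l; first by rewrite lee_fin kern_ge0.
  apply: (@le_trans _ _ (mu D)); first by apply: le_measure; rewrite ?inE//;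
    exact: measurableD.
  by rewrite /D lebesgue_measure_itv/= lte_fin ltrDl b0 -EFinD lee_fin; lra.
have Wfin : W n x \is a fin_num.
  rewrite ge0_fin_numE//; apply: (@le_lt_trans _ _ (b * kern_mass b n)%:E);
    last exact: ltry.
  rewrite split_mass leeDl//; apply: integral_ge0 => t _;
    by rewrite lee_fin kern_ge0.
have : ((b * kern_mass b n)%:E <= W n x + (b * kern b n d)%:E)%E.
  by rewrite split_mass; apply: leeD.
rewrite -(fineK Wfin) -EFinD !lee_fin; set w := fine _ => Hw.
set M := b * kern_mass b n in mass_ge Hw *.
suff : b * kern b n d <= M * (b / (d / 2) * (kern b 1 d / kern b 1 (d / 2)) ^+
  n) by nra.
have -> : b * kern b n d = (d / 2 * kern b n (d / 2)) *
    (b / (d / 2) * (kern b 1 d / kern b 1 (d / 2)) ^+ n).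
  rewrite (kX n d) (kX n (d / 2)) [(_ / kern b 1 (d / 2)) ^+ n]expr_div_n.
  have : kern b 1 (d / 2) ^+ n != 0 by rewrite expf_neq0// gt_eqF.
  move: (_ ^+ n) (_ ^+ n) => z y y0; field.
  by rewrite y0 gt_eqF.
apply: ler_wpM2r => //; apply: mulr_ge0; first by rewrite divr_ge0; lra.
by rewrite exprn_ge0// divr_ge0// kern_ge0.
Qed.

Let M n := b * kern_mass b n.

Let M_gt0 n : 0 < M n.
Proof.
rewrite mulr_gt0// /kern_mass (_ : nat_freqs n
  = 0 :: [seq k%:Z | k <- iota 1 n])//.
rewrite big_cons ltr_pwDl//; last first.
  by apply: sumr_ge0 => k _; exact: cmod2_ge0.
rewrite /kern_coef cmodM exprMn cmod_real cmod_cexp mulr1 exprn_gt0//.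
by rewrite bin0 divr_gt0// exprn_gt0.
Qed.

Let W_measurable n : measurable_fun D (W n).
Proof.
have m : measurable_fun (D `*` I) (fun p => (kern b n (p.1 - p.2))%:E).
  apply/measurable_EFinP; apply: kern_measurable; apply: measurable_funB;
    apply: measurable_funTS.
    exact: measurable_fst.
  exact: measurable_snd.
have k0 (p : R * R) : (D `*` I) p -> (0 <= (kern b n (p.1 - p.2))%:E)%E.
  by rewrite lee_fin kern_ge0.
exact (@measurable_inner_integral R _ _ (measurableTypeR R) (measurableTypeR R)
  mu D I mD mI _ m k0).
Qed.

(** Divided by the mass of the kernel, the windows W n tend to at least 1 inside
    the interval; Fatou's lemma turns the bound on the weighted integrals of g
    into a bound on its integral over the interval. *)
Lemma interval_average : (\int[mu]_(x in I) (g x)%:E <= (K * (v - u))%:E)%E.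
Proof.
pose h n x := ((M n)^-1%:E * (W n x * (g x)%:E))%E.
have mh n : measurable_fun D (h n).
  apply: measurable_funeM; apply: emeasurable_funM; first exact: W_measurable.
  exact/measurable_EFinP.
have Wg0 n x : (0 <= W n x * (g x)%:E)%E by rewrite mule_ge0// lee_fin.
have h0 n x : (0 <= h n x)%E.
  by rewrite mule_ge0// lee_fin invr_ge0 ltW.
have mhI n : measurable_fun I (h n) by apply: measurable_funS (mh n).
have hint n : (\int[mu]_(x in I) h n x <= (K * (v - u))%:E)%E.
  apply: (@le_trans _ _ (\int[mu]_(x in D) h n x)%E).
    by apply: ge0_subset_integral => //; first [exact: ID|exact: mh|move=> x _;
      exact: h0].
  rewrite /h ge0_integralZl_EFin//; last 2 first.
  - apply: emeasurable_funM; first exact: W_measurable.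
    exact/measurable_EFinP.
  - by rewrite invr_ge0 ltW.
  by rewrite lee_pdivrMl// muleC; exact: W_average.
apply: (@le_trans _ _ (limn_einf (fun n => \int[mu]_(x in I) h n x))%E);
  last first.
  by apply: limn_einf_le (cvg_cst _) => n; exact: hint.
apply: le_trans (fatou mu mI mhI (fun n x _ => h0 n x)).
apply: ge0_le_integral => //.
- by move=> x _; rewrite lee_fin.
- by apply/measurable_EFinP; apply: measurable_funS mg.
- apply: (emeasurable_fun_cvg (fun n x => einfs (h ^~ x) n)).
    exact: measurable_fun_einfs.
  by move=> x _; rewrite limn_einf_lim; exact: is_cvg_einfs.
move=> x Ix; have [q [q0 q1 [C WC]]] := W_concentrates Ix.
apply: (@le_limn_einf _ _ (fun n => ((1 - C * q ^+ n) * g x)%:E)).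
  move=> n; rewrite /h muleA EFinM; apply: lee_wpmul2r;
    first by rewrite lee_fin.
  by rewrite lee_pdivlMl// -EFinM; exact: WC.
apply: cvg_EFin; first exact: nearW.
rewrite -[X in _ --> X]mul1r; apply: cvgM; last exact: cvg_cst.
rewrite -[X in _ --> X]subr0; apply: cvgB; first exact: cvg_cst.
rewrite -(mulr0 C); apply: cvgM; first exact: cvg_cst.
by rewrite exprn_geometric; apply: cvg_geometric; rewrite ger0_norm.
Qed.

End one_interval.

(** Testing a nonnegative integrable function against the kernels, at rational
    centres only, bounds it almost everywhere. *)
Theorem ae_le_of_kernel_averages : {ae mu, forall x, D x -> g x <= K}.
Proof.
have igo : mu.-integrable [set` `]s, s + b[] (EFin \o g).
  by apply: integrableS ig => //; exact: subset_itv_oo_co.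
have := ae_le_of_interval_averages K0 igo
  (fun u v su uv vb => interval_average su uv vb).
have : {ae mu, forall x : R, x <> s}.
  exists [set s]; split => //; first exact: lebesgue_measure_set1.
  by move=> x /= /contrapT.
apply: ae_imp2 => x xs H; rewrite /D/= in_itv/= => /andP[sx xb]; apply: H.
by rewrite /= in_itv/= xb andbT lt_neqAle eq_sym sx andbT; apply/eqP.
Qed.

End kernel_averages.

(** * The pointwise bound *)

Section bound_on_transform.
Context {R : realType}.
Local Notation mu := (@lebesgue_measure R).
Local Notation mu2 := (@lebesgue_measure R \x @lebesgue_measure R)%E.
Variable a : R.
Hypothesis a1 : 1 < a.
Variables (L : nat) (psi : 'I_L -> R -> R[i]).
Hypothesis psi_L2 : forall l, L2 (psi l).
Variable B : R.
Hypothesis B0 : 0 < B.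
Variable F : 'I_L -> R * R -> R[i].
Hypothesis FT : forall l, is_theta a (psi l) (F l).

Let cell := theta_cell a.
Let F_measurable l : cmeasurable cell (F l).
Proof. by apply: theta_cell_measurable => //; case: (FT l). Qed.

Let gram p := \sum_(l < L) cmod (F l p) ^+ 2.

Let transform_sum r r' (c : label L -> R[i]) p :
  \sum_(i <- labels L r r') c i * (Lambda a i.1.1 p.1 * fmode (- i.1.2) p.2 * F
    i.2 p) =
  \sum_(l < L) (\sum_(m <- r) \sum_(j <- r')
     c (m, j, l) * (Lambda a m p.1 * fmode (- j) p.2)) * F l p.
Proof.
rewrite big_labels; under eq_bigr do rewrite exchange_big/=.
rewrite exchange_big/=; apply: eq_bigr => l _; rewrite mulr_suml.
by apply: eq_bigr => m _; rewrite mulr_suml; apply: eq_bigr => j _;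
  rewrite mulrA.
Qed.

(** The squared norm of a finite combination is the integral over the cell of
    |sum_l T_l F_l|^2 with trigonometric polynomials T_l.  The finite
    Cauchy-Schwarz inequality and the hypothesis bound it by B times the
    integral of sum_l |T_l|^2, which is the square sum of the coefficients. *)
Lemma bessel_of_bound :
  {ae mu2, forall p, cell p -> gram p <= B} -> bessel_MD psi a B.
Proof.
move=> H; apply: bessel_MD_of_finite => N f fL2.
apply: bessel_finite => // c.
pose T l p := \sum_(m <- irange N) \sum_(j <- irange N)
  c (m, j, l) * (Lambda a m p.1 * fmode (- j) p.2).
have mT l : cmeasurable cell (T l).
  exact: (cell_poly_measurable a1 (irange N) (irange N) (fun m j => c (m, j,
    l))).
rewrite -lee_fin (norm2_combine a1 psi_L2 _ c FT).
apply: (@le_trans _ _ (\int[mu2]_(p in cell) (B * \sum_(l < L) cmod (T l p) ^+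
  2)%:E)%E).
  apply: (@ae_ge0_le_integral _ (measurableTypeR R * measurableTypeR R)%type).
  - exact: measurable_theta_cell.
  - by move=> p _; rewrite lee_fin cmod2_ge0.
  - apply: measurable_ecmod2; apply: cmeasurable_sum => i.
    apply: cmeasurableM; first exact: cmeasurable_cst.
    apply: cmeasurableM; [exact: cell_mode_measurable|exact: F_measurable].
  - move=> p _; rewrite lee_fin; apply: mulr_ge0; first exact: ltW.
    by apply: sumr_ge0 => l _; exact: cmod2_ge0.
  - apply/measurable_EFinP; apply: measurable_funM => //.
    by apply: measurable_sum => l; exact (measurable_cmod2 (mT l)).
  move: H; apply: ae_imp => p H cp; rewrite lee_fin transform_sum.
  apply: (le_trans (cauchy_schwarz_sum _ _ _)); rewrite mulrC ler_wpM2r ?H//.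
  by apply: sumr_ge0 => l _; exact: cmod2_ge0.
under eq_integral do rewrite EFinM -sumEFin.
rewrite ge0_integralZl_EFin//; last 4 first.
- exact: measurable_theta_cell.
- by move=> p _; apply: sume_ge0 => l _; rewrite lee_fin cmod2_ge0.
- by apply: emeasurable_sum => l; exact (measurable_ecmod2 (mT l)).
- exact: ltW.
rewrite ge0_integral_sum//; last 3 first.
- exact: measurable_theta_cell.
- by move=> l; exact (measurable_ecmod2 (mT l)).
- by move=> l p _; rewrite lee_fin cmod2_ge0.
rewrite big_labels EFinM; apply: lee_wpmul2l; first by rewrite lee_fin ltW.
rewrite (_ : \sum_(l < L) _
  = (\sum_(l < L) \sum_(m <- irange N) \sum_(j <- irange N)
   cmod (c (m, j, l)) ^+ 2)%:E)%E; last first.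
  rewrite -sumEFin; apply: eq_bigr => l _.
  by rewrite -(sqn_cell_poly a1) ?irange_uniq.
rewrite lee_fin exchange_big/= le_eqVlt; apply/orP; left; apply/eqP.
by apply: eq_bigr => m _; rewrite exchange_big.
Qed.

Hypothesis bes : bessel_MD psi a B.

Let test_energy (z : 'I_L -> R[i]) p := cmod (\sum_(l < L) z l * F l p) ^+ 2.
Let size2 (z : 'I_L -> R[i]) := \sum_(l < L) cmod (z l) ^+ 2.

Let test_measurable z : cmeasurable cell (fun p => \sum_(l < L) z l * F l p).
Proof.
by apply: cmeasurable_sum => l; apply: cmeasurableM => //;
  exact: cmeasurable_cst.
Qed.

Let base_b0 : 0 < a - 1. Proof. by rewrite subr_gt0. Qed.

(** Bessel's inequality tested on the combination whose transform is the
    product of two kernels with a constant combination of the transforms. *)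
Let kernel_test n t k tau z :
  (\int[mu2]_(p in cell) (kern (a - 1) n (p.1 - t) *
      (kern 1 k (p.2 - tau) * test_energy z p))%:E
   <= (B * size2 z * kern_mass 1 k * ((a - 1) * kern_mass (a - 1) n))%:E)%E.
Proof.
pose c (i : label L) := z i.2 * (kern_coef (a - 1) n t i.1.1 * kern_coef 1 k
  tau i.1.2).
pose s := labels L (nat_freqs n) (nat_freqs k).
have bnd : norm2 (combine a psi s c) <= B * \sum_(i <- s) cmod (c i) ^+ 2.
  apply: synthesis_bound_of_bessel => // f fL2.
  by apply: bessel_MD_finite => //; exact: nat_freqs_uniq.
have cE : \sum_(i <- s) cmod (c i) ^+ 2
  = size2 z * kern_mass 1 k * kern_mass (a - 1) n.
  rewrite big_labels -(kern_coef_norm (a - 1) n t) -(kern_coef_norm 1 k tau).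
  rewrite mulrC mulr_suml; apply: eq_bigr => m _.
  rewrite !mulr_sumr; apply: eq_bigr => j _.
  rewrite /size2 mulr_suml mulr_sumr; apply: eq_bigr => l _.
  by rewrite /c !cmodM !exprMn/=; ring.
rewrite (_ : (\int[_]_(_ in _) _)%E
  = ((a - 1)%:E * (norm2 (combine a psi s c))%:E)%E).
  rewrite -EFinM lee_fin; have := ler_wpM2l (ltW base_b0) bnd.
  by rewrite cE => /le_trans; apply; rewrite le_eqVlt; apply/orP; left;
    apply/eqP; ring.
rewrite (norm2_combine a1 psi_L2 _ c FT) /sqn -ge0_integralZl_EFin//;
  last 4 first.
- exact: measurable_theta_cell.
- by move=> p _; rewrite lee_fin cmod2_ge0.
- apply: measurable_ecmod2; apply: cmeasurable_sum => i.
  apply: cmeasurableM; first exact: cmeasurable_cst.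
  apply: cmeasurableM; [exact: cell_mode_measurable|exact: F_measurable].
- exact: ltW.
apply: eq_integral => -[x xi] /set_mem[/= xb _]; rewrite -EFinM; congr EFin.
rewrite !kern_poly /test_energy transform_sum/=.
pose P := \sum_(m <- nat_freqs n) kern_coef (a - 1) n t m * Lambda a m x.
pose Q := \sum_(j <- nat_freqs k) kern_coef 1 k tau j * cexp_i (freq 1 j xi).
rewrite (_ : \sum_(m <- nat_freqs n) _ = (Num.sqrt (a - 1))%:C * P); last first.
  rewrite /P mulr_sumr; apply: eq_bigr => m _; rewrite Lambda_freq//.
  rewrite mulrCA; congr (_ * _); rewrite mulrA -rmorphM/= mulfV ?mul1r//.
  by rewrite gt_eqF// sqrtr_gt0.
rewrite (_ : \sum_(l < L) (\sum_(m <- _) _) * _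
  = P * Q * \sum_(l < L) z l * F l (x, xi)).
  by rewrite !cmodM !exprMn cmod_real sqr_sqrtr ?(ltW base_b0)//; ring.
rewrite mulr_sumr; apply: eq_bigr => l _; rewrite mulrA; congr (_ * _).
rewrite /P /Q !mulr_suml; apply: eq_bigr => m _.
rewrite mulr_sumr mulr_suml; apply: eq_bigr => j _.
rewrite /c/= fmode_freq opprK; ring.
Qed.

Let fibre k tau z x : \bar R :=
  (\int[mu]_(xi in period_itv) (kern 1 k (xi - tau) * test_energy z (x,
    xi))%:E)%E.

Let test_ge0 z p : 0 <= test_energy z p. Proof. exact: cmod2_ge0. Qed.

Let fibre_ge0 k tau z x : (0 <= fibre k tau z x)%E.
Proof.
by apply: integral_ge0 => xi _; rewrite lee_fin mulr_ge0// kern_ge0.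
Qed.

Let weighted_measurable k tau z :
  measurable_fun cell (fun p => (kern 1 k (p.2 - tau) * test_energy z p)%:E).
Proof.
apply/measurable_EFinP; apply: measurable_funM.
  apply: kern_measurable; apply: measurable_funB => //.
  by apply: measurable_funTS; exact: measurable_snd.
exact: measurable_cmod2.
Qed.

Let fibre_measurable k tau z : measurable_fun (base_itv a) (fibre k tau z).
Proof.
have w0 (p : R * R) : cell p ->
  (0 <= (kern 1 k (p.2 - tau) * test_energy z p)%:E)%E.
  by move=> _; rewrite lee_fin mulr_ge0// kern_ge0.
exact (@measurable_inner_integral R _ _ (measurableTypeR R) (measurableTypeR R)
  mu (base_itv a) period_itv (@measurable_base_itv R a) (@measurable_period_itv
    R)
  _ (weighted_measurable k tau z) w0).
Qed.

Let fibre_test n t k tau z :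
  (\int[mu]_(x in base_itv a) ((kern (a - 1) n (x - t))%:E * fibre k tau z x)
   <= (B * size2 z * kern_mass 1 k * ((a - 1) * kern_mass (a - 1) n))%:E)%E.
Proof.
apply: le_trans (kernel_test n t k tau z).
have m : measurable_fun cell (fun p => (kern (a - 1) n (p.1 - t) *
      (kern 1 k (p.2 - tau) * test_energy z p))%:E).
  apply/measurable_EFinP; apply: measurable_funM; last first.
    by apply/measurable_EFinP; exact: weighted_measurable.
  apply: kern_measurable; apply: measurable_funB => //.
  by apply: measurable_funTS; exact: measurable_fst.
have m0 (p : R * R) : cell p -> (0 <= (kern (a - 1) n (p.1 - t) *
      (kern 1 k (p.2 - tau) * test_energy z p))%:E)%E.
  move=> _; rewrite lee_fin; apply: mulr_ge0; first exact: kern_ge0.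
  by apply: mulr_ge0; [exact: kern_ge0|exact: test_ge0].
have T := @tonelli_rect R _ _ (measurableTypeR R) (measurableTypeR R)
  mu mu (base_itv a) period_itv (@measurable_base_itv R a)
    (@measurable_period_itv R) _ m m0.
rewrite le_eqVlt; apply/orP; left; apply/eqP; apply/esym.
apply: (eq_trans T); apply: eq_integral => x /set_mem xb.
rewrite /fibre -ge0_integralZl_EFin//.
- exact: measurable_period_itv.
- by move=> xi _; rewrite lee_fin mulr_ge0// kern_ge0.
- apply/measurable_EFinP; apply: measurable_funM.
    by apply: kern_measurable; exact: measurable_funB.
  apply: measurable_cmod2; apply: cmeasurable_sum => l; apply: cmeasurableM.
    exact: cmeasurable_cst.
  by apply: slice_measurable; [exact: base_itv_pos xb|case: (FT l)].
- exact: kern_ge0.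
Qed.

(** The kernels in x are removed by the averaging theorem, for a fixed kernel
    in xi.  The function to which it applies must be real valued, hence the use
    of fine; the fibre integrals are finite almost everywhere. *)
Let fibre_bound k tau z :
  {ae mu, forall x, base_itv a x ->
    (fibre k tau z x <= (B * size2 z * kern_mass 1 k)%:E)%E}.
Proof.
have K0 : 0 <= B * size2 z * kern_mass 1 k.
  by rewrite !mulr_ge0 ?(ltW B0)//; apply: sumr_ge0 => l _; exact: cmod2_ge0.
have bE : base_itv a = [set` `[1, 1 + (a - 1)[] by rewrite addrC subrK.
have fin : mu.-integrable (base_itv a) (fibre k tau z).
  apply/integrableP; split; first exact: fibre_measurable.
  under eq_integral do rewrite gee0_abs//.
  apply: (le_lt_trans _ (ltry (B * size2 z * kern_mass 1 k * ((a - 1) *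
    kern_mass (a - 1) 0)))).
  apply: le_trans (fibre_test 0 0 k tau z).
  by under [leRHS]eq_integral do rewrite /kern expr0 mul1e.
have ig : mu.-integrable [set` `[1,
  1 + (a - 1)[] (EFin \o (fine \o fibre k tau z)).
  rewrite -bE; apply: le_integrable fin.
  - exact: measurable_base_itv.
  - apply/measurable_EFinP; apply: measurableT_comp;
    first exact: fine_measurable.
    exact: fibre_measurable.
  move=> x _; rewrite /= ger0_norm ?fine_ge0// gee0_abs//.
  by have := fibre_ge0 k tau z x; case: (fibre k tau z x) => //= r;
    rewrite leey.
have H n (q : rat) : (\int[mu]_(x in [set` `[1%R, (1 + (a - 1))%R[])
    (kern (a - 1) n (x - ratr q) * (fine \o fibre k tau z) x)%:E <=
    (B * size2 z * kern_mass 1 k * ((a - 1) * kern_mass (a - 1) n))%:E)%E.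
  rewrite -bE; apply: le_trans (fibre_test n (ratr q) k tau z).
  apply: ge0_le_integral.
  - exact: measurable_base_itv.
  - by move=> x _; rewrite lee_fin mulr_ge0 ?kern_ge0// fine_ge0.
  - apply/measurable_EFinP; apply: measurable_funM.
      by apply: kern_measurable; exact: measurable_funB.
    apply: measurableT_comp; first exact: fine_measurable.
    exact: fibre_measurable.
  - apply: emeasurable_funM; last exact: fibre_measurable.
    by apply/measurable_EFinP; apply: kern_measurable; exact: measurable_funB.
  move=> x _; rewrite EFinM; apply: lee_wpmul2l;
    first by rewrite lee_fin kern_ge0.
  by have := fibre_ge0 k tau z x; rewrite /=; case: (fibre k tau z x) => //= r;
    rewrite leey.
have := ae_le_of_kernel_averages base_b0 K0 (fun x => fine_ge0 (fibre_ge0 k tau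
  z x)) ig H.
have := @integrable_ae _ (measurableTypeR R) R mu _ (@measurable_base_itv R a)
  _ fin.
apply: ae_imp2 => x h1 h2 xb; rewrite -(fineK (h1 xb)) lee_fin.
by apply: h2; rewrite -bE.
Qed.

(** The kernels in xi are removed in the same way on almost every fibre. *)
Let slice_bound z x : base_itv a x ->
  (forall k (q : rat), (fibre k (ratr q) z x
    <= (B * size2 z * kern_mass 1 k)%:E)%E) ->
  {ae mu, forall xi, period_itv xi -> test_energy z (x, xi) <= B * size2 z}.
Proof.
move=> xb H.
have pE : period_itv = [set` `[0, 0 + 1[] :> set R by rewrite add0r.
have mt : measurable_fun period_itv (fun xi => test_energy z (x, xi)).
  apply: measurable_cmod2; apply: cmeasurable_sum => l; apply: cmeasurableM.
    exact: cmeasurable_cst.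
  by apply: slice_measurable; [exact: base_itv_pos xb|case: (FT l)].
rewrite pE; apply: (@ae_le_of_kernel_averages _ 0 1) => //.
- by rewrite mulr_ge0 ?(ltW B0)//; apply: sumr_ge0 => l _; exact: cmod2_ge0.
- rewrite -pE; apply/integrableP; split; first exact/measurable_EFinP.
  apply: (le_lt_trans _ (ltry (B * size2 z * kern_mass 1 0))).
  apply: le_trans (H 0%N 0%Q); rewrite le_eqVlt; apply/orP; left; apply/eqP.
  by apply: eq_integral => xi _; rewrite gee0_abs ?lee_fin// /kern expr0 mul1r.
- by move=> n q; rewrite -pE mul1r; exact: H.
Qed.

(** Combinations with coefficients in (Z + iZ) / (N + 1): countably many, and
    dense in C^L. *)
Definition rational_coef (w : nat * {ffun 'I_L ->
  int * int}) (l : 'I_L) : R[i] :=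
  ((w.2 l).1%:~R / w.1.+1%:R) +i* ((w.2 l).2%:~R / w.1.+1%:R).

(** Let the coefficients tend to the conjugates of the w l, and let S be the sum
    of the |w l|^2: the inequality becomes S^2 <= B S. *)
Lemma dual_bound (w : 'I_L -> R[i]) :
  (forall v, cmod (\sum_(l < L) rational_coef v l * w l) ^+ 2
    <= B * size2 (rational_coef v)) ->
  \sum_(l < L) cmod (w l) ^+ 2 <= B.
Proof.
move=> H; set S := \sum_(l < L) _.
pose v N : nat * {ffun 'I_L -> int * int} := (N, [ffun l =>
  (Num.floor (complex.Re (w l) * N.+1%:R),
    Num.floor (- complex.Im (w l) * N.+1%:R))]).
have vRe l : complex.Re (rational_coef (v N) l) @[N --> \oo] --> complex.Re (w
  l).
  under eq_fun do rewrite /rational_coef/= ffunE/=.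
  exact: floor_approx.
have vIm l : complex.Im (rational_coef (v N) l) @[N --> \oo] --> - complex.Im
  (w l).
  under eq_fun do rewrite /rational_coef/= ffunE/=.
  exact: floor_approx.
have SE : S = \sum_(l < L) (complex.Re (w l) * complex.Re (w l) - - complex.Im
  (w l) * complex.Im (w l)).
  by apply: eq_bigr => l _; rewrite cmod2E; ring.
have cRe : complex.Re (\sum_(l < L) rational_coef (v N) l * w l) @[N --> \oo]
  --> S.
  under eq_fun do (rewrite cRe_sum; under eq_bigr do rewrite cReM).
  rewrite SE; apply: cvg_big; first exact: add_continuous.
  by move=> l _; apply: cvgB; apply: cvgM => //; exact: cvg_cst.
have csize : size2 (rational_coef (v N)) @[N --> \oo] --> S.
  have -> : S = \sum_(l < L) (complex.Re (w l) * complex.Re (w l)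
    + - complex.Im (w l) * - complex.Im (w l)).
    by apply: eq_bigr => l _; rewrite cmod2E; ring.
  rewrite /size2; under eq_fun do (under eq_bigr do rewrite cmod2E !expr2).
  apply: cvg_big; first exact: add_continuous.
  by move=> l _; apply: cvgD; apply: cvgM.
have S0 : 0 <= S by apply: sumr_ge0 => l _; exact: cmod2_ge0.
have SS : S * S <= B * S.
  have c1 : complex.Re (\sum_(l < L) rational_coef (v N) l * w l) ^+ 2 @[N -->
    \oo] --> S * S.
    by under eq_fun do rewrite expr2; exact: cvgM.
  have c2 : B * size2 (rational_coef (v N)) @[N --> \oo] --> B * S.
    by apply: cvgM => //; exact: cvg_cst.
  apply: (ler_cvg_to c1 c2).
  apply: nearW => N; apply: le_trans (H (v N)).
  by rewrite [leRHS]cmod2E lerDl sqr_ge0.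
have [->|Sn0] := eqVneq S 0; first exact: ltW.
by move: SS; rewrite ler_pM2r// lt_neqAle eq_sym Sn0.
Qed.

(** Only countably many tests are involved: the degree and the rational centre of
    the kernel in xi, and the coefficients.  So one null set of fibres serves for
    all of them. *)
Lemma bound_of_bessel : {ae mu2, forall p, cell p -> gram p <= B}.
Proof.
apply: (@ae_rect R _ _ (measurableTypeR R) (measurableTypeR R)).
- have m : measurable_fun cell gram.
    by apply: measurable_sum => l; exact: measurable_cmod2.
  have -> : cell `&` [set p | ~ gram p <= B] = cell `&` gram @^-1` `]B,
    +oo[%classic.
    by apply/seteqP; split => p [cp]; rewrite /= in_itv/= andbT ltNge => /negP.
  exact (m (@measurable_theta_cell R a) _ (measurable_itv _)).
have : {ae mu, forall x (i : nat * rat * (nat * {ffun 'I_L ->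
  int * int})), base_itv a x ->
    (fibre i.1.1 (ratr i.1.2) (rational_coef i.2) x <=
     (B * size2 (rational_coef i.2) * kern_mass 1 i.1.1)%:E)%E}.
  by apply: ae_forall_count => i; exact: fibre_bound.
apply: ae_imp => x H xb.
have : {ae mu, forall xi v, period_itv xi ->
    test_energy (rational_coef v) (x, xi) <= B * size2 (rational_coef v)}.
  apply: ae_forall_count => v; apply: slice_bound => // k q.
  exact: (H (k, q, v)).
by apply: ae_imp => xi Hxi xip; apply: dual_bound => v; exact: Hxi.
Qed.

End bound_on_transform.

(** * The Bessel criterion *)

Theorem theorem2p2 (R : realType) (a : R) (a_gt1 : 1 < a)
    (L : nat) (psi : 'I_L -> R -> R[i])
    (psi_L2 : forall l, L2 (psi l))
    (psi_distinct : forall l l', l != l' -> ~ eqL2 (psi l) (psi l'))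
    (B : R) (B_gt0 : 0 < B) :
  bessel_MD psi a B <->
  {ae (lebesgue_measure \x lebesgue_measure)%E, forall p : R * R,
    p.1 \in `[1, a[ -> p.2 \in `[0, 1[ ->
    \sum_(l < L) (cmod (Theta a (psi l) p)) ^+ 2 <= B}.
Proof.
have FT l : is_theta a (psi l) (Theta a (psi l)) by exact: Theta_is_theta.
split => [bes|H].
  have := bound_of_bessel a_gt1 psi_L2 B_gt0 FT bes.
  by apply: ae_imp => p H p1 p2; exact: H.
apply: (bessel_of_bound a_gt1 psi_L2 B_gt0 FT).
by move: H; apply: ae_imp => p H [p1 p2]; exact: H.
Qed.
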